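(* The ABLE operator defines a strictly larger class of operators than the Fourier Neural Operator (FNO). FNO is a special case of ABLE: when $p(x,y)$ is constant, the ABLE transformation $\mathcal{A}$ reduces to the Fourier transformation $\mathcal{F}$, and thus the ABLE operator $\mathcal{G}_{ABLE}=\mathcal{A}^{-1}\circ\hat{\mathcal{R}}_{ABLE}\circ\mathcal{A}$ reduces to the Fourier Neural Operator $\mathcal{G}_{FNO}=\mathcal{F}^{-1}\circ\hat{\mathcal{R}}\circ\mathcal{F}$. Furthermore, the ABLE operator induces kernels $K_{ABLE}(x,z)$ that are not necessarily translation-invariant (i.e. not necessarily of the form $K(x-z)$), and therefore the inclusion of the class of FNO operators in the class of ABLE operators is strict.
   Context: $E\subset\mathbb{R}^d$ is the spatial domain. $\mathcal{F}$ is the Fourier transform, $\mathcal{F}(f)(k)=(2\pi)^{-d/2}\int_E e^{-ik\cdot x}f(x)\,dx$, with inverse $\mathcal{F}^{-1}(\hat f)(x)=(2\pi)^{-d/2}\int_{\mathbb{R}^d}e^{ik\cdot x}\hat f(k)\,dk$. A Fourier Neural Operator (linear spectral layer) is $\mathcal{G}_{FNO}=\mathcal{F}^{-1}\circ\hat{\mathcal{R}}\circ\mathcal{F}$, where $\hat{\mathcal{R}}$ is multiplication by a learnable spectral multiplier $R(k)$; it is a convolution operator, with translation-invariant kernel $K(x-z)$. $\chi$ is an auxiliary measurable space with a probability measure $\mu$ (in implementation, the finite set $\{1,\dots,M\}$ with counting measure), and $p:E\times\chi\to\mathbb{R}_{\ge0}$ is a density with $\int_\chi p(x,y)\,\mu(dy)=1$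 for all $x\in E$; $p$ may also be parameterized as input-dependent, $p(x,f(x),y)$. The ABLE (Adaptive Basis Learning) transformation is $\mathcal{A}(f)_{k,y}=(2\pi)^{-d/2}\int_E\sqrt{p(x,y)}\,e^{-ik\cdot x}f(x)\,dx$, with inverse (on its image, and used as synthesis map) $\mathcal{A}^{-1}(\hat f)(x)=\int_\chi\sqrt{p(x,y)}\,\big((2\pi)^{-d/2}\int_{\mathbb{R}^d}e^{ik\cdot x}\hat f_{k,y}\,dk\big)\mu(dy)$. The ABLE operator is $\mathcal{G}_{ABLE}=\mathcal{A}^{-1}\circ\hat{\mathcal{R}}_{ABLE}\circ\mathcal{A}$, where $\hat{\mathcal{R}}_{ABLE}$ is multiplication by a learnable spectral multiplier $R(k,y)$. Its induced kernel, for which $\mathcal{G}_{ABLE}(f)(x)=\int_E K_{ABLE}(x,z)f(z)\,dz$, is $K_{ABLE}(x,z)=\int_\chi\sqrt{p(x,y)}\,R(x-z;y)\,\sqrt{p(z,y)}\,\mu(dy)$, where $R(x-z;y)=(2\pi)^{-d}\int_{\mathbb{R}^d}e^{ik\cdot(x-z)}R(k,y)\,dk$. *)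

(* Defs.v *)
(* MathComp-Analysis; complex numbers are [R[i]] from mathcomp-real-closed. *)
From HB Require Import structures.
From mathcomp Require Import all_boot all_order all_algebra.
From mathcomp Require Import complex.
From mathcomp Require Import all_classical all_reals all_analysis.

Set Implicit Arguments.
Unset Strict Implicit.
Unset Printing Implicit Defensive.
Import Order.TTheory GRing.Theory Num.Theory.
Import numFieldNormedType.Exports.
Local Open Scope classical_set_scope.
Local Open Scope ring_scope.

(* R^d, with the product (= Borel) sigma-algebra of the library's tuples. *)
Notation rspace R d := (d.-tuple (measurableTypeR R)).

Section lebesgue_rspace.
Context {R : realType}.

Definition rcons_point d (xt : measurableTypeR R * rspace R d) : rspace R d.+1 :=
  [the d.+1.-tuple (measurableTypeR R) of xt.1 :: xt.2].

Lemma measurable_rcons_point d : measurable_fun setT (@rcons_point d).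
Proof. by apply: measurable_cons; [exact: measurable_fst|exact: measurable_snd]. Qed.

Section step.
Variables (d : nat) (m : {sigma_finite_measure set (rspace R d) -> \bar R}).

Definition lebesgue_step : set (rspace R d.+1) -> \bar R :=
  pushforward (lebesgue_measure \x m)%E (@rcons_point d).

Let step0 : lebesgue_step set0 = 0%E.
Proof. by rewrite /lebesgue_step /pushforward preimage_set0 measure0. Qed.

Let step_ge0 A : (0 <= lebesgue_step A)%E.
Proof. by rewrite /lebesgue_step /pushforward; exact: measure_ge0. Qed.

Let step_sigma_additive : semi_sigma_additive lebesgue_step.
Proof.
move=> F mF tF mUF; rewrite /lebesgue_step /pushforward preimage_bigcup.
apply: measure_semi_sigma_additive.
- by move=> n; rewrite -[X in measurable X]setTI; exact: measurable_rcons_point.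
- apply/trivIsetP => /= i j _ _ ij; rewrite -preimage_setI.
  by move/trivIsetP : tF => /(_ _ _ _ _ ij) ->//; rewrite preimage_set0.
- rewrite -preimage_bigcup -[X in measurable X]setTI.
  exact: measurable_rcons_point.
Qed.

HB.instance Definition _ := isMeasure.Build _ _ _ lebesgue_step
  step0 step_ge0 step_sigma_additive.

Let uncons (t : rspace R d.+1) : measurableTypeR R * rspace R d :=
  (tnth t ord0, [tuple of behead t]).

Let measurable_uncons : measurable_fun setT uncons.
Proof.
apply/measurable_fun_pairP; split.
- exact: measurable_tnth.
- exact: measurable_behead.
Qed.

Let rcons_pointK : cancel (@rcons_point d) uncons.
Proof.
move=> [x t]; rewrite /uncons /rcons_point /=; congr pair.
by apply/val_inj.
Qed.

Let step_sigma_finite : sigma_finite setT lebesgue_step.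
Proof.
have /sigma_finiteP[F [TF ndF Foo]] := sigma_finiteT (@lebesgue_measure R).
have /sigma_finiteP[G [TG ndG Goo]] := sigma_finiteT m.
exists (fun n => uncons @^-1` (F n `*` G n)).
  rewrite -preimage_bigcup (_ : \bigcup_n _ = setT) ?preimage_setT//.
  rewrite -subTset => -[x y] _.
  have : setT x by []. have : setT y by [].
  rewrite TF TG => -[n _ Gny] [k _ Fkx].
  exists (maxn n k) => //; split => /=.
  - by move: Fkx; exact/subsetPset/ndF/leq_maxr.
  - by move: Gny; exact/subsetPset/ndG/leq_maxl.
move=> n; have [mF Fn] := Foo n; have [mG Gn] := Goo n; split.
  rewrite -[X in measurable X]setTI.
  by apply: measurable_uncons => //; exact: measurableX.
rewrite /lebesgue_step /pushforward -comp_preimage.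
rewrite (_ : _ \o _ = id) ?preimage_id; last first.
  by apply/funext => x /=; rewrite rcons_pointK.
by rewrite product_measure1E// lte_mul_pinfty// ge0_fin_numE.
Qed.

HB.instance Definition _ := Measure_isSigmaFinite.Build _ _ _ lebesgue_step
  step_sigma_finite.

End step.

(* Lebesgue measure on R^d: the d-fold product of [lebesgue_measure]. *)
Fixpoint lebesgue_rspace (d : nat) :
    {sigma_finite_measure set (rspace R d) -> \bar R} :=
  if d is d'.+1 then lebesgue_step (lebesgue_rspace d')
  else (\d_([tuple] : rspace R 0))%E.

Definition vdot d (k x : rspace R d) : R :=
  \sum_(i < d) (tnth k i : R) * (tnth x i : R).

Definition vsub d (x z : rspace R d) : rspace R d :=
  [tuple ((tnth x i : R) - (tnth z i : R) : measurableTypeR R) | i < d].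

End lebesgue_rspace.
Arguments lebesgue_rspace R d : clear implicits.

Section complex_integration.
Context {R : realType} {dT : measure_display} {T : measurableType dT}.

Definition cmeasurable (D : set T) (f : T -> R[i]) : Prop :=
  measurable_fun D (fun x => complex.Re (f x)) /\
  measurable_fun D (fun x => complex.Im (f x)).

Definition cintegrable (m : {measure set T -> \bar R}) (D : set T)
    (f : T -> R[i]) : Prop :=
  m.-integrable D (fun x => (complex.Re (f x))%:E) /\
  m.-integrable D (fun x => (complex.Im (f x))%:E).

(* Only meaningful for [cintegrable] integrands. *)
Definition cintegral (m : {measure set T -> \bar R}) (D : set T)
    (f : T -> R[i]) : R[i] :=
  ((\int[m]_(x in D) complex.Re (f x)) +i*
   (\int[m]_(x in D) complex.Im (f x)))%C.

End complex_integration.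

Definition cexpi {R : realType} (t : R) : R[i] := (cos t +i* sin t)%C.

Section operators.
Context {R : realType} {d : nat}.
Notation V := (rspace R d).
Notation leb := (lebesgue_rspace R d).
Implicit Types (E : set V) (f : V -> R[i]).

Definition fourier_const : R[i] := ((2 * pi) `^ (- (d%:R / 2)) : R)%:C%C.

Definition fourier E f (k : V) : R[i] :=
  fourier_const * cintegral leb E (fun x => cexpi (- vdot k x) * f x).

Definition inv_fourier (g : V -> R[i]) (x : V) : R[i] :=
  fourier_const * cintegral leb setT (fun k => cexpi (vdot k x) * g k).

Definition fno E (M : V -> R[i]) f : V -> R[i] :=
  inv_fourier (fun k => M k * fourier E f k).

(* The integrable signals at which the integrals defining [fno E M] converge. *)
Definition fno_dom E (M : V -> R[i]) : set (V -> R[i]) :=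
  [set f | cintegrable leb E f /\
           cintegrable leb setT (fun k => M k * fourier E f k)].

(* An operator on L^1(E) is its graph, a set of pairs (input, output). Signals
   are functions on all of R^d of which only the values on E matter, and outputs
   are taken up to equality almost everywhere on E. *)
Definition operator := set ((V -> R[i]) * (V -> R[i])).

Definition graph_on E (dom : set (V -> R[i]))
    (G : (V -> R[i]) -> (V -> R[i])) : operator :=
  [set fg | dom fg.1 /\ {ae leb, forall x, E x -> fg.2 x = G fg.1 x}].

Definition fno_class E : set operator :=
  [set graph_on E (fno_dom E M) (fno E M) | M in cmeasurable setT].

Section able.
Context {dc : measure_display} {chi : measurableType dc}.
Variables (E : set V) (mu : probability chi R).
Implicit Types (p : V -> chi -> R) (M : V -> chi -> R[i]).

Definition is_density p : Prop :=
  [/\ measurable_fun (E `*` setT) (fun xy : V * chi => p xy.1 xy.2),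
      forall x y, E x -> 0 <= p x y &
      forall x, E x -> (\int[mu]_y (p x y)%:E = 1)%E].

Definition multiplier M : Prop :=
  cmeasurable setT (fun ky : V * chi => M ky.1 ky.2).

Definition able_transform p f (k : V) (y : chi) : R[i] :=
  fourier_const * cintegral leb E
    (fun x => (Num.sqrt (p x y))%:C%C * cexpi (- vdot k x) * f x).

Definition able_synthesis p (g : V -> chi -> R[i]) (x : V) : R[i] :=
  cintegral mu setT
    (fun y => (Num.sqrt (p x y))%:C%C * inv_fourier (fun k => g k y) x).

Definition able p M f : V -> R[i] :=
  able_synthesis p (fun k y => M k y * able_transform p f k y).

(* As [fno_dom]: convergence of the integrals over E, over the frequencies and
   over chi, respectively. *)
Definition able_dom p M : set (V -> R[i]) :=
  [set f | [/\ cintegrable leb E f,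
    {ae mu, forall y, cintegrable leb E
       (fun x => (Num.sqrt (p x y))%:C%C * f x)},
    {ae mu, forall y, cintegrable leb setT
       (fun k => M k y * able_transform p f k y)} &
    {ae leb, forall x, E x -> cintegrable mu setT
       (fun y => (Num.sqrt (p x y))%:C%C *
          inv_fourier (fun k => M k y * able_transform p f k y) x)}]].

Definition able_class_on : set operator :=
  [set G | exists p M, [/\ is_density p, multiplier M &
                           G = graph_on E (able_dom p M) (able p M)]].

(* u |-> R(u; y), the inverse transform of the multiplier. *)
Definition multiplier_kernel M (u : V) (y : chi) : R[i] :=
  ((2 * pi) ^- d : R)%:C%C *
  cintegral leb setT (fun k => cexpi (vdot k u) * M k y).

Definition able_kernel p M (x z : V) : R[i] :=
  cintegral mu setT (fun y => (Num.sqrt (p x y))%:C%C *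
    multiplier_kernel M (vsub x z) y * (Num.sqrt (p z y))%:C%C).

End able.

(* All ABLE operators on E, over every auxiliary probability space. *)
Definition able_class E : set operator :=
  [set G | exists (dc : measure_display) (chi : measurableType dc)
             (mu : probability chi R), able_class_on E mu G].

(* K(x,z) = K0(x - z) up to null sets of x and z in E. *)
Definition translation_invariant E (K : V -> V -> R[i]) : Prop :=
  exists K0 : V -> R[i],
    {ae leb, forall x, E x ->
      {ae leb, forall z, E z -> K x z = K0 (vsub x z)}}.

End operators.

(* Main.v *)
Require Import Defs.
From HB Require Import structures.
From mathcomp Require Import all_boot all_order all_algebra.
From mathcomp Require Import complex.
From mathcomp Require Import all_classical all_reals all_analysis.
From mathcomp Require Import measurable_realfun.
From mathcomp Require Import ring lra.

Set Implicit Arguments.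
Unset Strict Implicit.
Unset Printing Implicit Defensive.
Import Order.TTheory GRing.Theory Num.Theory.
Import numFieldNormedType.Exports.
Local Open Scope classical_set_scope.
Local Open Scope ring_scope.

(* A constant density is 1, so everything there reduces to the definitions and,
   for multipliers depending on y, to Fubini.

   For strictness, fix A with 0 < w = mu A < 1 and take p(x, y) = sigmoid(x) for y
   in A, with p(x, .) constant off A, and R(k, y) = 1_A(y) m(k), with m the
   indicator of a cube. The kernel is then w g(x) r(x - z) g(z), where g, the
   square root of the sigmoid, strictly decreases along the first axis and r is
   the inverse transform of m. If E had a translation-invariant kernel, or if the
   operator were an FNO operator (which commutes with translations), the values at
   (x, z) and (x + s, z + s) would agree whenever these points lie in E, which is
   impossible as long as Re r(x - z) > 0. A Steinhaus-type argument provides s > 0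
   such that E and its translate by s overlap, inside a cube, in a set of positive
   measure, and Re r > 0 on differences of points of that cube once m is supported
   close enough to the origin. *)

(** * Complex-valued integrals *)

Section complex_parts.
Context {R : realType}.
Implicit Types x y : R[i].

Lemma complexP x y :
  complex.Re x = complex.Re y -> complex.Im x = complex.Im y -> x = y.
Proof. by case: x y => [a b] [c e] /= -> ->. Qed.

Lemma Re_complexM x y : complex.Re (x * y) =
  complex.Re x * complex.Re y - complex.Im x * complex.Im y.
Proof. by case: x y => [a b] [c e]. Qed.

Lemma Im_complexM x y : complex.Im (x * y) =
  complex.Re x * complex.Im y + complex.Im x * complex.Re y.
Proof. by case: x y => [a b] [c e]. Qed.

Lemma cexpiD (s t : R) : cexpi (s + t) = cexpi s * cexpi t.
Proof.
by apply: complexP; rewrite ?Re_complexM ?Im_complexM /= ?cosD ?sinD // addrC mulrC.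
Qed.

Lemma cexpi0 : cexpi (0 : R) = 1.
Proof. by apply: complexP; rewrite /= ?cos0 ?sin0. Qed.

Lemma cexpiN_mul (t : R) : cexpi t * cexpi (- t) = 1.
Proof. by rewrite -cexpiD subrr cexpi0. Qed.

End complex_parts.

Section complex_measurability.
Context {R : realType} {dT : measure_display} {T : measurableType dT}.
Implicit Types (D : set T) (f g : T -> R[i]).

Lemma cmeasurableM D f g :
  cmeasurable D f -> cmeasurable D g -> cmeasurable D (fun x => f x * g x).
Proof.
move=> [rf jf] [rg jg]; split.
- under eq_fun do rewrite Re_complexM.
  by apply: measurable_funB; apply: measurable_funM.
- under eq_fun do rewrite Im_complexM.
  by apply: measurable_funD; apply: measurable_funM.
Qed.

Lemma cmeasurable_real D (h : T -> R) :
  measurable_fun D h -> cmeasurable D (fun x => (h x)%:C%C).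
Proof. by move=> mh; split => //=; exact: measurable_cst. Qed.

Lemma cmeasurable_cexpi D (h : T -> R) :
  measurable_fun D h -> cmeasurable D (fun x => cexpi (h x)).
Proof.
move=> mh; split => /=; apply: (measurableT_comp _ mh).
- by apply: continuous_measurable_fun; exact: continuous_cos.
- by apply: continuous_measurable_fun; exact: continuous_sin.
Qed.

End complex_measurability.

Lemma cmeasurable_comp {R : realType} {d1 d2 : measure_display}
    {T1 : measurableType d1} {T2 : measurableType d2}
    (f : T2 -> R[i]) (h : T1 -> T2) :
  cmeasurable setT f -> measurable_fun setT h ->
  cmeasurable setT (fun x => f (h x)).
Proof.
by move=> [rf jf] mh; split;
  [exact: (measurableT_comp rf mh)|exact: (measurableT_comp jf mh)].
Qed.

Section complex_integral_theory.
Context {R : realType} {dT : measure_display} {T : measurableType dT}.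
Variable m : {measure set T -> \bar R}.
Implicit Types (D : set T) (f g : T -> R[i]).

Lemma eq_cintegral D f g :
  (forall x, D x -> f x = g x) -> cintegral m D f = cintegral m D g.
Proof.
by move=> fg; rewrite /cintegral; congr Complex;
  apply: eq_Rintegral => x; rewrite inE => /fg ->.
Qed.

Lemma eq_cintegrable D f g : measurable D ->
  (forall x, D x -> f x = g x) -> cintegrable m D f -> cintegrable m D g.
Proof.
by move=> mD fg [rf jf]; split; [move: rf|move: jf]; apply: eq_integrable => // x;
  rewrite inE => /fg ->.
Qed.

Lemma cintegrable_cmeasurable D f : cintegrable m D f -> cmeasurable D f.
Proof.
by move=> [/measurable_int/measurable_EFinP rf /measurable_int/measurable_EFinP jf].
Qed.

Lemma cintegral_mkcond D f : cintegral m D f = cintegral m setT (patch (fun=> 0) D f).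
Proof.
rewrite /cintegral; congr Complex; rewrite Rintegral_mkcond;
  by apply: eq_Rintegral => x _; rewrite /patch; case: ifP.
Qed.

Lemma cintegrable_mkcond D f : measurable D ->
  cintegrable m D f <-> cintegrable m setT (patch (fun=> 0) D f).
Proof.
move=> mD.
have eR : (fun x => (complex.Re (f x))%:E) \_ D =
          (fun x => (complex.Re (patch (fun=> 0) D f x))%:E).
  by apply/funext => x; rewrite /patch; case: ifP.
have eI : (fun x => (complex.Im (f x))%:E) \_ D =
          (fun x => (complex.Im (patch (fun=> 0) D f x))%:E).
  by apply/funext => x; rewrite /patch; case: ifP.
split=> -[rf jf].
- by split; rewrite -?eR -?eI; exact/(integrable_mkcond _ mD).1.
- by split; apply/(integrable_mkcond _ mD).2; rewrite ?eR ?eI.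
Qed.

(** Each part of the product is a sum or difference of products of a bounded and an integrable real
    function. Phases, constants and square roots of bounded densities all enter through this
    lemma. *)
Lemma cintegrableM_bounded D f g (c : R) : measurable D ->
  cmeasurable D f ->
  (forall x, D x -> `|complex.Re (f x)| <= c /\ `|complex.Im (f x)| <= c) ->
  cintegrable m D g -> cintegrable m D (fun x => f x * g x).
Proof.
move=> mD [mrf mjf] fc [rg jg].
have bR : [bounded complex.Re (f x) | x in D].
  exists c; split; first exact: num_real.
  by move=> k ck x Dx; exact: le_trans (fc x Dx).1 (ltW ck).
have bI : [bounded complex.Im (f x) | x in D].
  exists c; split; first exact: num_real.
  by move=> k ck x Dx; exact: le_trans (fc x Dx).2 (ltW ck).
split.
- under eq_fun do rewrite Re_complexM EFinB !EFinM.
  by apply: integrableB => //; exact: integrableMr.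
- under eq_fun do rewrite Im_complexM EFinD !EFinM.
  by apply: integrableD => //; exact: integrableMr.
Qed.

Lemma cintegrable_cexpiM D (h : T -> R) g : measurable D ->
  measurable_fun D h ->
  cintegrable m D g -> cintegrable m D (fun x => cexpi (h x) * g x).
Proof.
move=> mD mh; apply: (cintegrableM_bounded (c := 1)) => //.
  exact: cmeasurable_cexpi.
by move=> x _ /=; split; rewrite ler_norml ?cos_geN1 ?cos_le1 ?sin_geN1 ?sin_le1.
Qed.

Lemma cintegrableZl D f (c : R[i]) : measurable D ->
  cintegrable m D f -> cintegrable m D (fun x => c * f x).
Proof.
move=> mD; apply: (cintegrableM_bounded
  (c := Num.max `|complex.Re c| `|complex.Im c|)) => //.
by move=> x _; split; rewrite le_max lexx ?orbT.
Qed.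

Lemma cintegralZl D f (c : R[i]) : measurable D ->
  cintegrable m D f -> cintegral m D (fun x => c * f x) = c * cintegral m D f.
Proof.
have iZ (h : T -> R) (r : R) : measurable D -> m.-integrable D (EFin \o h) ->
    m.-integrable D (EFin \o (fun x => r * h x)).
  by move=> mD ih; rewrite /comp; under eq_fun do rewrite EFinM; exact: integrableZl.
move=> mD [rf jf]; apply: complexP; rewrite ?Re_complexM ?Im_complexM /cintegral /=.
- under eq_Rintegral do rewrite Re_complexM.
  by rewrite RintegralB// ?RintegralZl//; exact: iZ.
- under eq_Rintegral do rewrite Im_complexM.
  by rewrite RintegralD// ?RintegralZl//; exact: iZ.
Qed.

Lemma ae_eq_cintegral f g :
  cmeasurable setT f -> cmeasurable setT g ->
  {ae m, forall x, f x = g x} -> cintegral m setT f = cintegral m setT g.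
Proof.
move=> [rf jf] [rg jg] fg; rewrite /cintegral /Rintegral.
congr (Complex (fine _) (fine _)); apply: ae_eq_integral => //;
  try exact/measurable_EFinP.
all: by apply: filterS fg => x fgx _ /=; rewrite fgx.
Qed.

Lemma ae_eq_cintegrable f g :
  cmeasurable setT f -> cmeasurable setT g ->
  {ae m, forall x, f x = g x} -> cintegrable m setT f -> cintegrable m setT g.
Proof.
move=> [mrf mjf] [mrg mjg] fg [/integrableP[_ rf] /integrableP[_ jf]].
split; apply/integrableP; split; try exact/measurable_EFinP.
- rewrite (ae_eq_integral (fun x => `|(complex.Re (f x))%:E|)%E)//.
  + exact/measurableT_comp/measurable_EFinP.
  + exact/measurableT_comp/measurable_EFinP.
  + by apply: filterS fg => x fgx _ /=; rewrite fgx.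
- rewrite (ae_eq_integral (fun x => `|(complex.Im (f x))%:E|)%E)//.
  + exact/measurableT_comp/measurable_EFinP.
  + exact/measurableT_comp/measurable_EFinP.
  + by apply: filterS fg => x fgx _ /=; rewrite fgx.
Qed.

End complex_integral_theory.

Section complex_probability.
Context {R : realType} {dT : measure_display} {T : measurableType dT}.
Variable mu : probability T R.

Lemma cintegrable_cst (c : R[i]) : cintegrable mu setT (fun=> c).
Proof.
by split; apply: (finite_measure_integrable_cst mu _ measurableT).
Qed.

Lemma cintegral_cst (c : R[i]) : cintegral mu setT (fun=> c) = c.
Proof.
by apply: complexP; rewrite /cintegral /= Rintegral_cst//
  [X in fine X]probability_setT mulr1.
Qed.

(** If [P] failed, the exceptional set would be the whole space, which has mass 1. *)
Lemma ae_cst (P : Prop) : {ae mu, forall y, P} <-> P.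
Proof.
split=> [[N [mN N0 PN]]|HP]; last exact: aeW.
apply: contrapT => nP.
have : mu setT = 0%E.
  by apply: (subset_measure0 _ mN) => //; apply: subset_trans PN => x _.
by rewrite probability_setT => /eqP; rewrite onee_eq0.
Qed.

End complex_probability.

(** [fine] sends infinite values to 0, so it never increases the absolute value. This passes from
    the extended inner integrals of Fubini's theorem to the real ones inside [cintegral]. *)
Lemma integrable_fine_EFin {R : realType} {dT : measure_display}
    {T : measurableType dT} (m : {measure set T -> \bar R}) (F : T -> \bar R) :
  m.-integrable setT F -> m.-integrable setT (fun x => (fine (F x))%:E).
Proof.
move=> /integrableP[mF iF].
have mfF : measurable_fun setT (fun x => (fine (F x))%:E).
  apply/measurable_EFinP; exact: (measurableT_comp (fine_measurable measurableT) mF).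
apply/integrableP; split => //; apply: le_lt_trans iF.
apply: ge0_le_integral => //; [exact: measurableT_comp..|].
by move=> x _; case: (F x) => //=; rewrite ?normr0 ?leey.
Qed.

(** * Fubini's theorem for complex integrands *)

Section complex_fubini.
Context {R : realType} {d1 d2 : measure_display}.
Context {T1 : measurableType d1} {T2 : measurableType d2}.
Variables (m1 : {sigma_finite_measure set T1 -> \bar R}).
Variables (m2 : {sigma_finite_measure set T2 -> \bar R}).

(** Tonelli gives measurability of the integrals of the positive and negative parts separately, so
    measurability of [f] suffices. *)
Lemma cmeasurable_cintegral (f : T1 * T2 -> R[i]) :
  cmeasurable setT f ->
  cmeasurable setT (fun x => cintegral m2 setT (fun y => f (x, y))).
Proof.
have key (h : T1 * T2 -> R) : measurable_fun setT h ->
    measurable_fun setT (fun x => \int[m2]_y h (x, y)).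
  move=> mh; rewrite /Rintegral.
  have mE : measurable_fun setT (fun z => (h z)%:E) by exact/measurable_EFinP.
  apply: (measurableT_comp (f := fine)); first exact: fine_measurable.
  pose F (u : T1 * T2 -> \bar R) x := (\int[m2]_y u (x, y))%E.
  rewrite (_ : (fun x => _) =
      (F ((EFin \o h)^\+) \- F ((EFin \o h)^\-))%E); last first.
    apply/funext => x; rewrite [LHS]integralE /F /=.
    by congr (_ - _)%E; apply: eq_integral => y _; rewrite ?funeposE ?funenegE.
  apply: emeasurable_funB.
  - apply: (measurable_fun_fubini_tonelli_F _ (measurable_funepos mE)).
    exact: funepos_ge0.
  - apply: (measurable_fun_fubini_tonelli_F _ (measurable_funeneg mE)).
    exact: funeneg_ge0.
by move=> [rf jf]; split; [exact: key _ rf|exact: key _ jf].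
Qed.

(** By Tonelli, the absolute value of a tensor product integrates to the product of the two finite
    integrals. *)
Lemma cintegrable_prodM (f : T1 -> R[i]) (g : T2 -> R[i]) :
  cintegrable m1 setT f -> cintegrable m2 setT g ->
  cintegrable (m1 \x m2)%E setT (fun z => f z.1 * g z.2).
Proof.
have key (u : T1 -> R) (v : T2 -> R) : m1.-integrable setT (EFin \o u) ->
    m2.-integrable setT (EFin \o v) ->
    (m1 \x m2)%E.-integrable setT (fun z => (u z.1 * v z.2)%:E).
  move=> iu iv.
  have mu : measurable_fun setT u by exact/measurable_EFinP/(measurable_int m1).
  have mv : measurable_fun setT v by exact/measurable_EFinP/(measurable_int m2).
  apply/integrable12ltyP.
    apply/measurable_EFinP/measurable_funM.
    - exact: measurableT_comp.
    - exact: measurableT_comp.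
  have nv : (\int[m2]_y `|v y|%:E)%E \is a fin_num.
    exact: integrable_fin_num (integrable_norm iv).
  rewrite (eq_integral (fun x => (`|u x|%:E * \int[m2]_y `|v y|%:E)%E)); last first.
    move=> x _ /=; rewrite -ge0_integralZl//.
    - by apply: eq_integral => y _; rewrite -EFinM normrM.
    - by apply/measurable_EFinP; exact: measurableT_comp.
  have := integrable_norm iu.
  move=> /integrableP[_]; under eq_integral do rewrite /= normr_id.
  rewrite -(fineK nv) => iu'.
  rewrite (eq_integral (fun x => ((fine (\int[m2]_y `|v y|%:E))%:E *
     `|u x|%:E)%E)); last by move=> x _; rewrite muleC.
  rewrite ge0_integralZl//.
  - by rewrite lte_mul_pinfty// lee_fin fine_ge0// integral_ge0.
  - by apply/measurable_EFinP; exact: measurableT_comp.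
  - by rewrite lee_fin fine_ge0// integral_ge0.
move=> [rf jf] [rg jg]; split.
- under eq_fun do rewrite Re_complexM EFinB.
  exact: (integrableB _ (key _ _ rf rg) (key _ _ jf jg)).
- under eq_fun do rewrite Im_complexM EFinD.
  exact: (integrableD _ (key _ _ rf jg) (key _ _ jf rg)).
Qed.

Variable f : T1 * T2 -> R[i].
Hypothesis intf : cintegrable (m1 \x m2)%E setT f.

Lemma ae_cintegrable1 :
  {ae m1, forall x, cintegrable m2 setT (fun y => f (x, y))}.
Proof.
have [/ae_integrable1 rf /ae_integrable1 jf] := intf.
by apply: filterS2 rf jf => x ? ?; split.
Qed.

Lemma ae_cintegrable2 :
  {ae m2, forall y, cintegrable m1 setT (fun x => f (x, y))}.
Proof.
have [/ae_integrable2 rf /ae_integrable2 jf] := intf.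
by apply: filterS2 rf jf => x ? ?; split.
Qed.

(** The inner integral is dominated by the inner integral of the absolute value, which Tonelli makes
    integrable. *)
Let integrable_fubini_G (h : T1 * T2 -> R) :
  (m1 \x m2)%E.-integrable setT (EFin \o h) ->
  m2.-integrable setT (fubini_G m1 (EFin \o h)).
Proof.
move=> ih; have mh := measurable_int _ ih.
apply/integrableP; split; first exact: (measurable_fubini_G ih).
apply: le_lt_trans ((integrable21ltyP m1 m2 mh).1 ih).
apply: ge0_le_integral => //.
- by apply: measurableT_comp => //; exact: (measurable_fubini_G ih).
- apply: (measurable_fun_fubini_tonelli_G (abse \o (EFin \o h))) => //=.
  exact: measurableT_comp.
- move=> y _; apply: le_abse_integral => //; exact: measurableT_comp.
Qed.

Lemma cintegrable_cintegral1 :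
  cintegrable m1 setT (fun x => cintegral m2 setT (fun y => f (x, y))).
Proof.
have [rf jf] := intf; split.
- exact: integrable_fine_EFin (integrable_fubini_F rf).
- exact: integrable_fine_EFin (integrable_fubini_F jf).
Qed.

Lemma cintegrable_cintegral2 :
  cintegrable m2 setT (fun y => cintegral m1 setT (fun x => f (x, y))).
Proof.
have [rf jf] := intf; split.
- exact: integrable_fine_EFin (integrable_fubini_G rf).
- exact: integrable_fine_EFin (integrable_fubini_G jf).
Qed.

Lemma cFubini :
  cintegral m1 setT (fun x => cintegral m2 setT (fun y => f (x, y))) =
  cintegral m2 setT (fun y => cintegral m1 setT (fun x => f (x, y))).
Proof.
have key (h : T1 * T2 -> R) : (m1 \x m2)%E.-integrable setT (EFin \o h) ->
    \int[m1]_x \int[m2]_y h (x, y) = \int[m2]_y \int[m1]_x h (x, y).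
  move=> ih; rewrite /Rintegral.
  have h1 := integrable_fubini_F ih; have h2 := integrable_fubini_G ih.
  (* Real and extended inner integrals agree wherever the section is integrable, that is, almost
     everywhere. *)
  transitivity (fine (\int[m1]_x \int[m2]_y (h (x, y))%:E)).
    congr fine; apply: ae_eq_integral => //.
    - apply/measurable_EFinP/(measurableT_comp (f := fine)).
        exact: fine_measurable.
      exact: measurable_int h1.
    - exact: measurable_int h1.
    - have := ae_integrable1 ih; apply: filterS => x ix _ /=.
      by rewrite fineK//; exact: integrable_fin_num.
  rewrite (Fubini ih); congr fine; apply: ae_eq_integral => //.
  - exact: measurable_int h2.
  - apply/measurable_EFinP/(measurableT_comp (f := fine)).
      exact: fine_measurable.
    exact: measurable_int h2.
  - have := ae_integrable2 ih; apply: filterS => x ix _ /=.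
    by rewrite fineK//; exact: integrable_fin_num.
by have [rf jf] := intf; rewrite /cintegral /= (key _ rf) (key _ jf).
Qed.

End complex_fubini.

(** * Translations and cubes *)

(** The image of Lebesgue measure under the shift has the same values on half-open intervals, and
    these determine the measure. *)
Lemma lebesgue_measure_translate {R : realType} (s : R) (A : set R) :
  measurable A ->
  lebesgue_measure ((fun t : R => t + s) @^-1` A) = lebesgue_measure A.
Proof.
move=> mA.
have mT : measurable_fun setT
    ((fun t : R => t + s) : measurableTypeR R -> measurableTypeR R).
  by apply: measurable_funD => //; exact: measurable_cst.
pose T : {mfun measurableTypeR R >-> measurableTypeR R} :=
  HB.pack ((fun t : R => t + s) : measurableTypeR R -> measurableTypeR R)
    (isMeasurableFun.Build _ _ _ _ _ mT).
apply/esym/(lebesgue_measure_unique (mu := pushforward lebesgue_measure T)) => //.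
move=> _ [[a b]] _ <- /=; rewrite /pushforward /=.
have -> : (fun t : R => t + s) @^-1` `]a, b]%classic = `]a - s, b - s]%classic.
  by apply/seteqP; split => t /=; rewrite !in_itv /= ltrBlDr lerBrDr.
rewrite !lebesgue_measure_itv /= !lte_fin ltrD2r.
by case: ifP => // _; rewrite -!EFinB; congr EFin; ring.
Qed.

(** [\x] integrates sections over the first variable and [\x^] over the second; both agree on
    rectangles, so uniqueness of the product measure identifies them. *)
Lemma product_measure_ysection {R : realType} {d1 d2 : measure_display}
    {T1 : measurableType d1} {T2 : measurableType d2}
    (m1 : {sigma_finite_measure set T1 -> \bar R})
    (m2 : {sigma_finite_measure set T2 -> \bar R}) (A : set (T1 * T2)) :
  measurable A -> (m1 \x m2)%E A = (\int[m2]_y m1 (ysection A y))%E.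
Proof.
move=> mA; apply: (product_measure_unique (m' := (m1 \x^ m2)%E)) => // B C mB mC.
exact: product_measure2E.
Qed.

Section space.
Context {R : realType}.
Notation V d := (rspace R d).
Notation leb d := (lebesgue_rspace R d).
Notation leb1 := (@lebesgue_measure R).

(** Testing the value of [i] instead of comparing with [ord0] makes the definition available in
    every dimension; in dimension 0 it is the identity. *)
Definition translate d (s : R) (x : V d) : V d :=
  [tuple ((tnth x i : R) + (if i == 0%N :> nat then s else 0)
    : measurableTypeR R) | i < d].

Lemma tnth_translate d s (x : V d) i :
  tnth (translate s x) i = (tnth x i : R) + (if i == 0%N :> nat then s else 0).
Proof. by rewrite tnth_mktuple. Qed.

Lemma translateK d s : cancel (@translate d s) (translate (- s)).
Proof.
move=> x; apply: eq_from_tnth => i; rewrite !tnth_translate.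
by case: ifP => _; rewrite ?addrK ?addr0.
Qed.

Lemma tnth_vsub d (x z : V d) i :
  tnth (vsub x z) i = (tnth x i : R) - (tnth z i : R).
Proof. by rewrite tnth_mktuple. Qed.

Lemma vsub_translate d s (x z : V d) : vsub (translate s x) (translate s z) = vsub x z.
Proof.
apply: eq_from_tnth => i; rewrite !tnth_vsub !tnth_translate.
by case: ifP => _; ring.
Qed.

Lemma vdot_translate d s (k x : V d.+1) :
  vdot k (translate s x) = vdot k x + s * (tnth k ord0 : R).
Proof.
rewrite /vdot big_ord_recl [X in _ = X + _]big_ord_recl tnth_translate /=.
rewrite (eq_bigr (fun i : 'I_d => (tnth k (lift ord0 i) : R) *
  (tnth x (lift ord0 i) : R))); first by ring.
by move=> i _; rewrite tnth_translate /= addr0.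
Qed.

Lemma vdot_vsub d (k x z : V d) : vdot k (vsub x z) = vdot k x - vdot k z.
Proof.
rewrite /vdot -sumrB; apply: eq_bigr => i _.
by rewrite tnth_vsub mulrBr.
Qed.

Lemma translate_rcons d s t (y : V d) :
  translate s (rcons_point (t, y)) = rcons_point (t + s, y).
Proof.
apply: eq_from_tnth => i; rewrite tnth_translate.
case: (unliftP ord0 i) => [j|] -> /=.
  by rewrite /rcons_point /= !tnthS addr0.
by rewrite /rcons_point /= !tnth0.
Qed.

Lemma measurable_translate_pair d :
  measurable_fun setT (fun p : measurableTypeR R * V d => translate p.1 p.2).
Proof.
apply/measurable_fun_tnthP => i.
rewrite (_ : _ \o _ = fun p : measurableTypeR R * V d =>
  (tnth p.2 i : R) + (if i == 0%N :> nat then p.1 : R else 0)); last first.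
  by apply/funext => p /=; rewrite tnth_translate.
apply: measurable_funD.
  exact: (measurableT_comp (measurable_tnth i) measurable_snd).
by case: (i == 0%N :> nat); [exact: measurable_fst|exact: measurable_cst].
Qed.

Lemma measurable_translate d s : measurable_fun setT (@translate d s).
Proof. exact: (measurable_fun_pair2 s (@measurable_translate_pair d)). Qed.

Lemma measurable_translate_preimage d s (A : set (V d)) :
  measurable A -> measurable (translate s @^-1` A).
Proof.
by move=> mA; rewrite -[X in measurable X]setTI; exact: measurable_translate.
Qed.

Lemma lebesgue_rspaceS d (A : set (V d.+1)) :
  leb d.+1 A = (leb1 \x leb d)%E (@rcons_point R d @^-1` A).
Proof. by []. Qed.

Lemma measurable_rcons_preimage d (A : set (V d.+1)) :
  measurable A -> measurable (@rcons_point R d @^-1` A).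
Proof.
by move=> mA; rewrite -[X in measurable X]setTI; exact: measurable_rcons_point.
Qed.

Lemma lebesgue_rspaceSE d (A : set (V d.+1)) : measurable A ->
  leb d.+1 A = (\int[leb d]_y leb1 [set t | A (rcons_point (t, y))])%E.
Proof.
move=> mA; rewrite lebesgue_rspaceS product_measure_ysection; last first.
  exact: measurable_rcons_preimage.
by apply: eq_integral => y _; rewrite ysectionE.
Qed.

Lemma measurable_fiber d (A : set (V d.+1)) y : measurable A ->
  measurable ([set t | A (rcons_point (t, y))] : set (measurableTypeR R)).
Proof.
move=> /measurable_rcons_preimage/(measurable_ysection y).
by rewrite ysectionE.
Qed.

(** The shift acts on each fibre along the first axis, where one-dimensional invariance applies. *)
Lemma lebesgue_translate d s (A : set (V d)) : measurable A ->
  leb d (translate s @^-1` A) = leb d A.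
Proof.
case: d A => [|d] A mA.
  congr (_ _); apply/seteqP; split => x /=;
    by rewrite [translate s x]tuple0 [x]tuple0.
rewrite !lebesgue_rspaceSE//; last exact: measurable_translate_preimage.
apply: eq_integral => y _.
rewrite -[RHS](lebesgue_measure_translate s); last exact: measurable_fiber.
by congr (_ _); apply/seteqP; split => t /=; rewrite translate_rcons.
Qed.

Lemma negligible_translate d s (A : set (V d)) :
  (leb d).-negligible A -> (leb d).-negligible (translate s @^-1` A).
Proof.
move=> [N [mN N0 AN]]; exists (translate s @^-1` N); split.
- exact: measurable_translate_preimage.
- by rewrite lebesgue_translate.
- by move=> x /AN.
Qed.

Let integral_translate d s (h : V d -> \bar R) : measurable_fun setT h ->
  (forall x, 0 <= h x)%E ->
  (\int[leb d]_x h (translate s x) = \int[leb d]_x h x)%E.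
Proof.
move=> mh h0.
have := ge0_integral_pushforward (@measurable_translate d s) (leb d) measurableT mh
  (fun x _ => h0 x).
rewrite preimage_setT => <-.
apply: eq_measure_integral => [|mT A mA _]; first exact: measurable_translate.
exact: lebesgue_translate.
Qed.

Lemma cintegrable_translate d s (f : V d -> R[i]) : cintegrable (leb d) setT f ->
  cintegrable (leb d) setT (fun x => f (translate s x)).
Proof.
have key (h : V d -> R) : (leb d).-integrable setT (EFin \o h) ->
    (leb d).-integrable setT (EFin \o (fun x => h (translate s x))).
  move=> /integrableP[mh ih]; apply/integrableP; split.
    exact: (measurableT_comp mh (@measurable_translate d s)).
  rewrite (integral_translate s (h := fun x => `|(h x)%:E|%E))//.
  exact: measurableT_comp.
by move=> [rf jf]; split; [exact: key _ rf|exact: key _ jf].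
Qed.

Lemma cintegral_translate d s (f : V d -> R[i]) : cintegrable (leb d) setT f ->
  cintegral (leb d) setT (fun x => f (translate s x)) = cintegral (leb d) setT f.
Proof.
have key (h : V d -> R) : (leb d).-integrable setT (EFin \o h) ->
    \int[leb d]_x h (translate s x) = \int[leb d]_x h x.
  move=> /measurable_int mh; rewrite /Rintegral; congr fine.
  rewrite [LHS]integralE [RHS]integralE; congr (_ - _)%E.
  - rewrite -(integral_translate s (h := ((EFin \o h)^\+)%E))//.
    + by apply: eq_integral => x _; rewrite !funeposE.
    + exact: measurable_funepos.
  - rewrite -(integral_translate s (h := ((EFin \o h)^\-)%E))//.
    + by apply: eq_integral => x _; rewrite !funenegE.
    + exact: measurable_funeneg.
by move=> [rf jf]; rewrite /cintegral (key _ rf) (key _ jf).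
Qed.

Definition box d (r : R) : set (V d) :=
  [set x | forall i, `|tnth x i : R| <= r].
Arguments box d r : clear implicits.

Lemma measurable_box d r : measurable (box d r).
Proof.
have -> : box d r = \bigcap_(i in [set: 'I_d])
    ((@tnth d (measurableTypeR R))^~ i @^-1` `[- r, r]%classic).
  apply/seteqP; split => [x xr i _|x xr i]; move: (xr i) => /=;
    by rewrite in_itv /= ler_norml // => /(_ I).
apply: fin_bigcap_measurable => // i _.
rewrite -[X in measurable X]setTI; exact: measurable_tnth.
Qed.

Lemma lebesgue_box d r : 0 <= r -> leb d (box d r) = ((2 * r) ^+ d)%:E.
Proof.
move=> r0; elim: d => [|d IH].
  by rewrite /= diracE mem_set// => -[].
have -> : leb d.+1 (box d.+1 r) = (leb1 \x leb d)%E
    ((`[- r, r]%classic : set (measurableTypeR R)) `*` box d r).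
  rewrite lebesgue_rspaceS; congr (_ _); apply/seteqP; split => -[t y] /=.
    move=> H; split => /=.
      by have := H ord0; rewrite /rcons_point /= tnth0 in_itv /= ler_norml.
    by move=> i; have := H (lift ord0 i); rewrite /rcons_point /= tnthS.
  move=> [/=]; rewrite in_itv /= -ler_norml => tr yr i.
  by case: (unliftP ord0 i) => [j|] ->; rewrite /rcons_point /= ?tnthS ?tnth0.
rewrite product_measure1E; [|exact: measurable_itv|exact: measurable_box].
rewrite IH exprS EFinM; congr (_ * _)%E.
have : leb1 `[(- r)%R, r]%classic = (2 * r)%:E; last exact.
rewrite lebesgue_measure_itv /= lte_fin.
(* If the end points are not in strict order, then [r = 0] and both sides vanish. *)
case: ltP => [_|rr]; first by rewrite -EFinB; congr EFin; ring.
by congr EFin; lra.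
Qed.

Lemma lebesgue_box_lty d r : 0 <= r -> (leb d (box d r) < +oo)%E.
Proof. by move=> r0; rewrite lebesgue_box// ltry. Qed.

Lemma lebesgue_box_gt0 d r : 0 < r -> (0 < leb d (box d r))%E.
Proof.
by move=> r0; rewrite lebesgue_box ?ltW// lte_fin exprn_gt0// mulr_gt0.
Qed.

(** [E] is the countable union of its intersections with cubes of integer size, so these cannot all
    be null. *)
Lemma exists_box d (E : set (V d)) : measurable E -> (0 < leb d E)%E ->
  exists2 r : R, 0 <= r & (0 < leb d (E `&` box d r))%E.
Proof.
move=> mE E0; apply: contrapT => H.
have : (leb d).-negligible (\bigcup_n (E `&` box d n%:R)).
  apply: negligible_bigcup => n; apply/negligibleP.
    by apply: measurableI => //; exact: measurable_box.
  apply/eqP; rewrite eq_le measure_ge0 andbT leNgt; apply/negP => h.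
  by apply: H; exists n%:R.
have -> : \bigcup_n (E `&` box d n%:R) = E.
  apply/seteqP; split => [x [n _ []]//|x Ex].
  (* The sum of the absolute values bounds every coordinate, so any larger integer gives a cube
     containing [x]. *)
  pose M := \sum_(i < d) `|tnth x i : R|.
  exists (Num.trunc M).+1 => //; split => // i.
  apply: le_trans (ltW (truncnS_gt _)).
  by rewrite /M (bigD1 i)//= lerDl sumr_ge0.
by move=> /negligibleP => /(_ mE) E00; rewrite E00 ltxx in E0.
Qed.

(* Integrating [lebesgue (E `&` translate s @^-1` E)] over s gives, fibre by fibre
   along the first axis, the square of the measure of the fibre of E. *)
Lemma exists_translate_overlap d (E : set (V d.+1)) :
  measurable E -> (0 < leb d.+1 E)%E ->
  exists2 s : R, 0 < s & (0 < leb d.+1 (E `&` translate s @^-1` E))%E.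
Proof.
move=> mE E0.
(* The overlap for [- s] is a translate of the overlap for [s], so the sign of the shift is
   immaterial. *)
suff [s s0 Es] : exists2 s : R, s != 0 & (0 < leb d.+1 (E `&` translate s @^-1` E))%E.
  have [s_gt0|s_le0] := ltP 0 s; first by exists s.
  exists (- s); first by rewrite oppr_gt0 lt_neqAle s0.
  rewrite (_ : _ `&` _ = translate (- s) @^-1` (E `&` translate s @^-1` E)).
    rewrite lebesgue_translate//; apply: measurableI => //.
    exact: measurable_translate_preimage.
  apply/seteqP; split => x /=; have := translateK (- s) x; rewrite opprK => ->;
    by move=> [].
apply: contrapT => H.
have {}H s : s != 0 -> leb d.+1 (E `&` translate s @^-1` E) = 0%E.
  move=> s0; apply/eqP; rewrite eq_le measure_ge0 andbT leNgt; apply/negP => h.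
  by apply: H; exists s.
(* Pairs of a shift and a point that stays in [E] under it. [W] is sliced first by shifts, then by
   points. *)
pose W : set (measurableTypeR R * V d.+1) := [set p | E p.2 /\ E (translate p.1 p.2)].
have mW : measurable W.
  apply: measurableI.
  - by rewrite -[X in measurable X]setTI; exact: measurable_snd.
  - by rewrite -[X in measurable X]setTI; exact: measurable_translate_pair.
have W0 : (leb1 \x leb d.+1)%E W = 0%E.
  (* Only the slice at shift 0 can have positive measure, and a single shift is negligible. *)
  rewrite /product_measure1 /=.
  rewrite (ae_eq_integral (cst 0%E)) ?integral0//.
    exact: measurable_fun_xsection.
  exists [set (0 : R)]; split => //; first exact: lebesgue_measure_set1.
  move=> s /= Hs; apply: contrapT => /eqP s0; apply: Hs => _.
  by rewrite -[RHS](H s s0) xsectionE.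
move: W0; rewrite product_measure_ysection// => W0.
pose phi (y : V d) := leb1 [set t | E (rcons_point (t, y))].
have mphi : measurable_fun setT phi.
  have := measurable_fun_ysection leb1 (measurable_rcons_preimage mE).
  apply: eq_measurable_fun => y _ /=.
  by rewrite ysectionE.
pose tl (x : V d.+1) : V d := [tuple of behead x].
have tlE t y : tl (rcons_point (t, y)) = y.
  by apply/val_inj.
have rconsE x : rcons_point (tnth x ord0, tl x) = x.
  by rewrite [RHS]tuple_eta; apply/val_inj.
(* The shifts that keep [x] in [E] form the fibre of [E] through [x], moved by the first coordinate
   of [x]. *)
have phiE x : E x -> leb1 (ysection W x) = phi (tl x).
  move=> Ex; rewrite /phi -[RHS](lebesgue_measure_translate (tnth x ord0)); last first.
    exact: measurable_fiber.
  have tE t : translate t x = rcons_point (t + tnth x ord0, tl x).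
    by rewrite -{1}[x]rconsE translate_rcons addrC.
  by congr (_ _); rewrite ysectionE; apply/seteqP; split => t /=;
    rewrite /W /= tE; [case|].
(* The points of [E] on fibres of positive measure. They have non-null slices in the null set [W],
   hence form a null set. *)
pose E' := E `&` [set x | phi (tl x) != 0%E].
have mE' : measurable E'.
  apply: measurableI => //.
  rewrite (_ : [set x | _] = (phi \o tl) @^-1` ~` [set 0%E]); last first.
    by apply/seteqP; split => x /= /eqP.
  rewrite -[X in measurable X]setTI.
  have mt : measurable_fun setT (phi \o tl).
    exact: (measurableT_comp mphi (@measurable_behead _ _ _)).
  by apply: mt => //; exact/measurableC/emeasurable_set1.
have E'0 : leb d.+1 E' = 0%E.
  apply/(negligibleP _ mE').
  have : \forall x \ae leb d.+1, leb1 (ysection W x) = 0%E.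
    have := (ae_eq_integral_abs (leb d.+1) measurableT
      (measurable_fun_ysection leb1 mW)).1.
    rewrite (eq_integral (fun y => leb1 (ysection W y))); last first.
      by move=> y _ /=; rewrite gee0_abs.
    by move=> /(_ W0); apply: filterS => x /(_ I).
  apply: negligibleS => x [Ex /= /eqP px] Wx; apply: px.
  by rewrite -phiE.
(* Passing from [E] to [E'] discards only null fibres, so by Tonelli the measure does not change. *)
suff : leb d.+1 E' = leb d.+1 E by move=> E'E; rewrite -E'E E'0 ltxx in E0.
rewrite !lebesgue_rspaceSE//; apply: eq_integral => y _; rewrite -/(phi y).
have [p0|p0] := eqVneq (phi y) 0%E.
  rewrite p0 (_ : [set t | _] = set0) ?measure0//.
  by apply/seteqP; split => // t [_ /=]; rewrite tlE p0 eqxx.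
congr (_ _); apply/seteqP; split => t /=; first by case.
by move=> Et; split => //=; rewrite tlE.
Qed.

End space.
Arguments box {R} d r.

(** * Fourier transforms and constant densities *)

Section fourier_theory.
Context {R : realType} {d : nat}.
Notation V := (rspace R d).
Notation leb := (lebesgue_rspace R d).
Local Notation fc := (@fourier_const R d).
Implicit Types (E : set V) (f m : V -> R[i]).

Lemma measurable_vdot : measurable_fun setT (fun p : V * V => vdot p.1 p.2).
Proof.
rewrite /vdot; apply: measurable_sum => i; apply: measurable_funM.
- exact: (measurableT_comp (measurable_tnth i) measurable_fst).
- exact: (measurableT_comp (measurable_tnth i) measurable_snd).
Qed.

Lemma measurable_vdotr (x : V) : measurable_fun setT (fun k : V => vdot k x).
Proof. exact: (measurable_fun_pair1 x measurable_vdot). Qed.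

Lemma measurable_vdotl (k : V) : measurable_fun setT (fun x : V => vdot k x).
Proof. exact: (measurable_fun_pair2 k measurable_vdot). Qed.

(** Extension by zero moves the integral to the whole space, where the translation and Fubini lemmas
    are stated. *)
Lemma fourierE E f k : fourier E f k = fc *
  cintegral leb setT (fun x => cexpi (- vdot k x) * patch (fun=> 0) E f x).
Proof.
rewrite /fourier cintegral_mkcond; congr (_ * _); apply: eq_cintegral => x _.
by rewrite /patch; case: ifP; rewrite ?mulr0.
Qed.

Lemma cmeasurable_fourier E f : measurable E -> cintegrable leb E f ->
  cmeasurable setT (fourier E f).
Proof.
move=> mE /(cintegrable_mkcond _ _ mE)/cintegrable_cmeasurable mf.
rewrite (_ : fourier E f = fun k => fc * cintegral leb setT
    (fun x => cexpi (- vdot k x) * patch (fun=> 0) E f x)); last first.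
  by apply/funext => k; rewrite fourierE.
apply: cmeasurableM; first by split; exact: measurable_cst.
apply: (cmeasurable_cintegral leb (f := fun p : V * V =>
  cexpi (- vdot p.1 p.2) * patch (fun=> 0) E f p.2)).
apply: cmeasurableM; last exact: (cmeasurable_comp mf measurable_snd).
by apply: cmeasurable_cexpi; apply: measurable_funN; exact: measurable_vdot.
Qed.

Lemma fourier_const_sqr :
  fc * fc = ((2 * pi) ^- d : R)%:C%C :> R[i].
Proof.
have p0 : 0 < 2 * pi :> R by rewrite mulr_gt0// pi_gt0.
rewrite /fourier_const -rmorphM /=; congr (_%:C)%C.
rewrite -powRD; last by rewrite (gt_eqF p0) implybT.
rewrite -opprD -splitr powRN powR_mulrn// ltW//.
Qed.

(** The analogue of [multiplier_kernel] for a multiplier without auxiliary variable. Its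
    normalisation is the product of those of the transform and of its inverse. *)
Definition conv_kernel m (u : V) : R[i] :=
  ((2 * pi) ^- d : R)%:C%C * cintegral leb setT (fun k => cexpi (vdot k u) * m k).

Section convolution.
Variables (E : set V) (m f : V -> R[i]).
Hypotheses (mE : measurable E) (im : cintegrable leb setT m).
Hypothesis (intf : cintegrable leb E f).

Let g := patch (fun=> 0) E f.

Let ig : cintegrable leb setT g.
Proof. exact: (cintegrable_mkcond leb f mE).1. Qed.

(** All double integrals of this section have this shape: a phase of modulus 1 times the tensor
    product of two integrable functions. *)
Let integrable_phase (h : V * V -> R) : measurable_fun setT h ->
  cintegrable (leb \x leb)%E setT (fun p => cexpi (h p) * (m p.1 * g p.2)).
Proof.
move=> mh; apply: cintegrable_cexpiM => //.
exact: (cintegrable_prodM im ig).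
Qed.

Lemma cintegrable_mul_fourier :
  cintegrable leb setT (fun k => m k * fourier E f k).
Proof.
have ms : measurable_fun setT (fun p : V * V => - vdot p.1 p.2).
  by apply: measurable_funN; exact: measurable_vdot.
have := cintegrableZl (fc) measurableT
  (cintegrable_cintegral1 (integrable_phase ms)).
apply: eq_cintegrable => // k _ /=; rewrite fourierE mulrCA; congr (_ * _).
rewrite -cintegralZl//; first by apply: eq_cintegral => x _; rewrite mulrCA.
by apply: cintegrable_cexpiM => //; apply: measurable_funN; exact: measurable_vdotl.
Qed.

Let phase (x : V) (p : V * V) : R := vdot p.1 x - vdot p.1 p.2.

Let measurable_phase x : measurable_fun setT (phase x).
Proof.
apply: measurable_funB; last exact: measurable_vdot.
exact: (measurableT_comp (measurable_vdotr x) measurable_fst).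
Qed.

Let conv_kernelE x z : conv_kernel m (vsub x z) * g z =
  ((2 * pi) ^- d : R)%:C%C *
  cintegral leb setT (fun k => cexpi (phase x (k, z)) * (m k * g z)).
Proof.
rewrite /conv_kernel -mulrA; congr (_ * _); rewrite mulrC -cintegralZl//; last first.
  by apply: cintegrable_cexpiM => //; exact: measurable_vdotr.
by apply: eq_cintegral => k _; rewrite /phase /= vdot_vsub; ring.
Qed.

Lemma cintegrable_conv_kernel x :
  cintegrable leb E (fun z => conv_kernel m (vsub x z) * f z).
Proof.
apply/(cintegrable_mkcond _ _ mE).
have := cintegrableZl (((2 * pi) ^- d : R)%:C%C) measurableT
  (cintegrable_cintegral2 (integrable_phase (measurable_phase x))).
apply: eq_cintegrable => // z _ /=; rewrite -conv_kernelE /g /patch.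
by case: ifP => _; rewrite ?mulr0.
Qed.

(** The convolution theorem: integrability of both [m] and [f] allows exchanging the frequency and
    space integrals, and the two phases combine into that of [vsub x z]. *)
Lemma inv_fourier_mul_fourier x :
  inv_fourier (fun k => m k * fourier E f k) x =
  cintegral leb E (fun z => conv_kernel m (vsub x z) * f z).
Proof.
have iphase := integrable_phase (measurable_phase x).
rewrite [RHS]cintegral_mkcond.
rewrite (eq_cintegral _ (g := fun z => ((2 * pi) ^- d : R)%:C%C *
    cintegral leb setT (fun k => cexpi (phase x (k, z)) * (m k * g z)))); last first.
  by move=> z _; rewrite -conv_kernelE /g /patch; case: ifP => _; rewrite ?mulr0.
rewrite cintegralZl//; last exact: (cintegrable_cintegral2 iphase).
rewrite -(cFubini iphase) -fourier_const_sqr -mulrA /inv_fourier; congr (_ * _).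
rewrite -cintegralZl//; last exact: (cintegrable_cintegral1 iphase).
apply: eq_cintegral => k _; rewrite fourierE.
rewrite [in RHS](eq_cintegral _ (g := fun z => (cexpi (vdot k x) * m k) *
    (cexpi (- vdot k z) * g z))); last first.
  by move=> z _; rewrite /phase /= cexpiD; ring.
rewrite [in RHS]cintegralZl//; first by rewrite /g; ring.
by apply: cintegrable_cexpiM => //; apply: measurable_funN; exact: measurable_vdotl.
Qed.

End convolution.
End fourier_theory.

(** * Reduction of ABLE to FNO for constant densities *)

Section constant_density.
Context {R : realType} {d : nat}.
Notation V := (rspace R d).
Notation leb := (lebesgue_rspace R d).
Context {dc : measure_display} {chi : measurableType dc}.
Variables (E : set V) (mu : probability chi R) (p : V -> chi -> R).
Hypothesis mE : measurable E.

(** Since [mu] has mass 1, the normalisation of the density forces the constant to be 1. *)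
Lemma constant_density_eq1 : is_density E mu p ->
  (exists c : R, forall x y, E x -> p x y = c) ->
  forall x y, E x -> Num.sqrt (p x y) = 1.
Proof.
move=> [_ _ pint] [c pc] x y Ex; rewrite pc//.
have := pint x Ex; rewrite (eq_integral (cst c%:E)); last by move=> z _; rewrite pc.
rewrite integral_cst//= [X in (_ * X)%E]probability_setT mule1 => -[->].
by rewrite sqrtr1.
Qed.

Hypothesis p1 : forall x y, E x -> Num.sqrt (p x y) = 1.

Lemma able_transform_constant f k y : able_transform E p f k y = fourier E f k.
Proof.
rewrite /able_transform /fourier; congr (_ * _); apply: eq_cintegral => x Ex.
by rewrite p1// mul1r.
Qed.

Lemma able_synthesis_constant g x : E x ->
  able_synthesis mu p (fun k _ => g k) x = inv_fourier g x.
Proof.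
move=> Ex; rewrite /able_synthesis -[RHS](cintegral_cst mu).
by apply: eq_cintegral => y _; rewrite p1// mul1r.
Qed.

Lemma able_constant M f x : E x ->
  able E mu p (fun k _ => M k) f x = fno E M f x.
Proof.
move=> Ex; rewrite /able.
rewrite (_ : (fun k y => _) = fun k _ => M k * fourier E f k).
  exact: able_synthesis_constant.
by apply/funext => k; apply/funext => y; rewrite able_transform_constant.
Qed.

Lemma able_dom_constantP M f : able_dom E mu p M f <->
  [/\ cintegrable leb E f,
      {ae mu, forall y, cintegrable leb setT (fun k => M k y * fourier E f k)} &
      {ae leb, forall x, E x -> cintegrable mu setT
         (fun y => inv_fourier (fun k => M k y * fourier E f k) x)}].
Proof.
have E1 y : (fun k => M k y * able_transform E p f k y) =
            (fun k => M k y * fourier E f k).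
  by apply/funext => k; rewrite able_transform_constant.
have E2 x y : E x -> (Num.sqrt (p x y))%:C%C *
    inv_fourier (fun k => M k y * able_transform E p f k y) x =
    inv_fourier (fun k => M k y * fourier E f k) x.
  by move=> Ex; rewrite (p1 y Ex) mul1r E1.
split=> [[intf _ h1 h2]|[intf h1 h2]].
- split; first exact: intf.
    by apply: filterS h1 => y; rewrite E1.
  apply: filterS h2 => x h2 Ex; apply: (eq_cintegrable measurableT _ (h2 Ex)).
  by move=> y _; rewrite E2.
- split; first exact: intf.
  + apply: aeW => y; apply: (eq_cintegrable mE _ intf) => x Ex.
    by rewrite (p1 y Ex) mul1r.
  + by apply: filterS h1 => y; rewrite E1.
  + apply: filterS h2 => x h2 Ex; apply: (eq_cintegrable measurableT _ (h2 Ex)).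
    by move=> y _; rewrite E2.
Qed.

Lemma able_dom_constant M : able_dom E mu p (fun k _ => M k) = fno_dom E M.
Proof.
apply/seteqP; split => f.
  by move=> /able_dom_constantP[intf /ae_cst iM _].
move=> [intf iM]; apply/able_dom_constantP; split => //; first exact/ae_cst.
by apply: aeW => x _; exact: cintegrable_cst.
Qed.

(** With unit weights, [y] enters only through the multiplier, and Fubini moves the average over [y]
    inside the inverse transform. *)
Lemma able_constant_mean (M : V -> chi -> R[i]) f :
  multiplier M -> cintegrable leb E f ->
  cintegrable (leb \x mu)%E setT (fun ky => M ky.1 ky.2 * fourier E f ky.1) ->
  let M_mean k := cintegral mu setT (M k) in
  [/\ able_dom E mu p M f, fno_dom E M_mean f &
      forall x, E x -> able E mu p M f x = fno E M_mean f x].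
Proof.
move=> mM intf iMF M_mean.
have iphase x : cintegrable (leb \x mu)%E setT (fun ky : V * chi =>
    cexpi (vdot ky.1 x) * (M ky.1 ky.2 * fourier E f ky.1)).
  apply: cintegrable_cexpiM => //.
  exact: (measurableT_comp (measurable_vdotr x) measurable_fst).
have mF := cmeasurable_fourier mE intf.
have mMm : cmeasurable setT M_mean.
  exact: (cmeasurable_cintegral mu mM).
have aeM : {ae leb, forall k, cintegral mu setT (fun y => M k y * fourier E f k) =
    M_mean k * fourier E f k}.
  apply: filterS (ae_cintegrable1 iMF) => k /= iM.
  (* Integrability of [M k] in [y] is recovered by dividing by the Fourier coefficient; where that
     vanishes, both sides are 0. *)
  have [F0|F0] := eqVneq (fourier E f k) 0.
    rewrite F0 mulr0 -[RHS](cintegral_cst mu).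
    by apply: eq_cintegral => y _; rewrite mulr0.
  have iMk : cintegrable mu setT (M k).
    have := cintegrableZl (fourier E f k)^-1 measurableT iM.
    by apply: eq_cintegrable => // y _; rewrite mulrC mulfK.
  rewrite mulrC -cintegralZl//; apply: eq_cintegral => y _; exact: mulrC.
have mMF := cmeasurableM mMm mF.
have domM : fno_dom E M_mean f.
  split => //; apply: (ae_eq_cintegrable _ mMF aeM (cintegrable_cintegral1 iMF)).
  exact: cintegrable_cmeasurable (cintegrable_cintegral1 iMF).
split => //.
  apply/able_dom_constantP; split => //; first exact: ae_cintegrable2 iMF.
  apply: aeW => x _; apply: cintegrableZl => //.
  exact: cintegrable_cintegral2 (iphase x).
move=> x Ex; rewrite /able /able_synthesis.
rewrite (eq_cintegral _ (g := fun y => @fourier_const R d * cintegral leb setT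
    (fun k => cexpi (vdot k x) * (M k y * fourier E f k)))); last first.
  move=> y _; rewrite (p1 y Ex) mul1r /inv_fourier; apply: congr1.
  by apply: eq_cintegral => k _; rewrite able_transform_constant.
rewrite cintegralZl//; last exact: cintegrable_cintegral2 (iphase x).
rewrite -(cFubini (iphase x)) /fno /inv_fourier; congr (_ * _).
apply: ae_eq_cintegral.
- exact: cintegrable_cmeasurable (cintegrable_cintegral1 (iphase x)).
- apply: cmeasurableM mMF; apply: cmeasurable_cexpi; exact: measurable_vdotr.
- apply: filterS2 aeM (ae_cintegrable1 iMF) => k <- /= iM.
  by rewrite -cintegralZl.
Qed.

End constant_density.

(** Take the density 1 and a multiplier independent of [y]. The domains coincide too, so the two
    graphs are equal. *)
Lemma fno_class_sub_able {R : realType} {d : nat} {dc : measure_display}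
    {chi : measurableType dc} (E : set (rspace R d)) (mu : probability chi R) :
  measurable E -> fno_class E `<=` able_class_on E mu.
Proof.
move=> mE G [M mM <-]; exists (fun _ _ => 1), (fun k _ => M k).
have p1 (x : rspace R d) (y : chi) : E x -> Num.sqrt (1 : R) = 1.
  by rewrite sqrtr1.
split.
- split=> [|x y _|x _]; [exact: measurable_cst|exact: ler01|].
  by rewrite integral_cst//= [X in (_ * X)%E]probability_setT mule1.
- exact: (cmeasurable_comp mM measurable_fst).
- rewrite /graph_on (able_dom_constant (p := fun _ _ => 1) mu mE p1).
  by apply/seteqP; split => -[f h] /= [df fh]; split => //;
    apply: filterS fh => x fh Ex; rewrite fh// able_constant.
Qed.

(** * Translation covariance *)

Section measure_facts.
Context {R : realType} {dT : measure_display} {T : measurableType dT}.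
Variable m : {measure set T -> \bar R}.

(** A set of positive measure is not contained in a null set; this turns almost-everywhere
    statements into actual points. *)
Lemma ae_exists (B : set T) (P : T -> Prop) : measurable B -> (0 < m B)%E ->
  {ae m, forall x, P x} -> exists2 x, B x & P x.
Proof.
move=> mB B0 [N [mN N0 PN]]; apply: contrapT => H.
suff B00 : m B = 0%E by rewrite B00 ltxx in B0.
apply: (subset_measure0 mB mN) => // x Bx.
by apply: PN => /= Px; apply: H; exists x.
Qed.

(** A nonnegative function with integral 0 vanishes almost everywhere, hence at some point of the
    non-null set [D]. *)
Lemma Rintegral_gt0 (D : set T) (f : T -> R) : measurable D -> (0 < m D)%E ->
  m.-integrable D (EFin \o f) -> (forall x, D x -> 0 < f x) ->
  0 < \int[m]_(x in D) f x.
Proof.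
move=> mD D0 intf f0.
rewrite lt_neqAle Rintegral_ge0 ?andbT; last by move=> x /f0/ltW.
apply/negP => /eqP If0.
have If : (\int[m]_(x in D) `|(f x)%:E| = 0)%E.
  rewrite -[0%E]/(0%:E) If0 /Rintegral fineK; last exact: integrable_fin_num.
  by apply: eq_integral => x; rewrite inE => /f0/ltW ?; rewrite /= ger0_norm.
have /ae_eq_integral_abs := If.
move=> /(_ mD (measurable_int _ intf))/(ae_exists mD D0)[x Dx /(_ Dx)].
by move=> [fx0]; have := f0 x Dx; rewrite fx0 ltxx.
Qed.

Lemma cintegrable_indic (B : set T) : measurable B -> (m B < +oo)%E ->
  cintegrable m setT (fun x => (\1_B x : R)%:C%C).
Proof.
move=> mB Boo; split => /=; last exact: integrable0.
apply/integrableP; split; first exact/measurable_EFinP.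
rewrite (eq_integral (fun x => (\1_B x)%:E)); first by rewrite integral_indic ?setIT.
by move=> x _; rewrite gee0_abs// lee_fin.
Qed.

Lemma cintegral0 (D : set T) : measurable D ->
  cintegral m D (fun=> 0) = 0 :> R[i].
Proof.
by move=> mD; apply: complexP; rewrite /cintegral /= Rintegral_cst ?mul0r.
Qed.

End measure_facts.

Section translation_covariance.
Context {R : realType} {d : nat}.
Notation V := (rspace R d.+1).
Notation leb := (lebesgue_rspace R d.+1).

Lemma ae_translate s (P : V -> Prop) :
  {ae leb, forall x, P x} -> {ae leb, forall x, P (translate s x)}.
Proof. by move=> /(negligible_translate s). Qed.

(** The relation is imposed on the extensions by zero because [E] itself may not be invariant under
    the shift; a change of variables then produces the phase. *)
Lemma fourier_translate (E : set V) (f g : V -> R[i]) s k : measurable E ->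
  cintegrable leb E f -> cintegrable leb E g ->
  (forall x, patch (fun=> 0) E g (translate s x) = patch (fun=> 0) E f x) ->
  fourier E g k = cexpi (- (s * (tnth k ord0 : R))) * fourier E f k.
Proof.
move=> mE intf intg gf.
have mvk : measurable_fun setT (fun x : V => - vdot k x).
  by apply: measurable_funN; exact: measurable_vdotl.
have iF : cintegrable leb setT
    (fun x => cexpi (- vdot k x) * patch (fun=> 0) E f x).
  by apply: cintegrable_cexpiM => //; exact/(cintegrable_mkcond _ _ mE).
have iG : cintegrable leb setT
    (fun x => cexpi (- vdot k x) * patch (fun=> 0) E g x).
  by apply: cintegrable_cexpiM => //; exact/(cintegrable_mkcond _ _ mE).
rewrite !fourierE -(cintegral_translate s iG) mulrCA; apply: congr1.
rewrite -cintegralZl//; apply: eq_cintegral => x _.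
by rewrite gf vdot_translate opprD addrC cexpiD mulrA.
Qed.

(** The phase produced by shifting the input cancels the one produced by shifting the output
    point. *)
Lemma fno_translate (E : set V) (M f g : V -> R[i]) s x : measurable E ->
  cintegrable leb E f -> cintegrable leb E g ->
  (forall x, patch (fun=> 0) E g (translate s x) = patch (fun=> 0) E f x) ->
  fno E M g (translate s x) = fno E M f x.
Proof.
move=> mE intf intg gf; rewrite /fno /inv_fourier; apply: congr1.
apply: eq_cintegral => k _; rewrite (fourier_translate k mE intf intg gf).
rewrite vdot_translate cexpiD -[RHS]mul1r -(cexpiN_mul (s * tnth k ord0)); ring.
Qed.

Variables (E : set V) (K : V -> V -> R[i]) (s : R) (B : set V).
Hypotheses (mE : measurable E) (mB : measurable B).
Hypotheses (B_gt0 : (0 < leb B)%E) (BE : B `<=` E).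
Hypothesis BsE : B `<=` translate s @^-1` E.
Hypothesis K_lt : forall x z, B x -> B z ->
  complex.Re (K (translate s x) (translate s z)) < complex.Re (K x z).

(** Choose [x], then [z], in [B] so that the identity with [K0] holds at the pair and at its
    translate. Both pairs have the same difference, against [K_lt]. *)
Lemma not_translation_invariant : ~ translation_invariant E K.
Proof.
move=> [K0 HK].
have [x Bx [Kx Ksx]] : exists2 x, B x &
    (E x -> {ae leb, forall z, E z -> K x z = K0 (vsub x z)}) /\
    (E (translate s x) -> {ae leb, forall z, E z ->
      K (translate s x) z = K0 (vsub (translate s x) z)}).
  by apply: (ae_exists mB B_gt0); apply: filterS2 HK (ae_translate s HK).
have [z Bz [Kxz Ksxz]] : exists2 z, B z &
    (E z -> K x z = K0 (vsub x z)) /\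
    (E (translate s z) -> K (translate s x) (translate s z) =
      K0 (vsub (translate s x) (translate s z))).
  apply: (ae_exists mB B_gt0).
  by apply: filterS2 (Kx (BE Bx)) (ae_translate s (Ksx (BsE Bx))).
have := K_lt Bx Bz.
by rewrite Kxz ?Ksxz ?vsub_translate ?ltxx//; [exact: BsE|exact: BE].
Qed.

(** Test the operator on the indicator of [B] and on its translate. Covariance would equate two
    integrals over [B] whose integrands have strictly ordered real parts. *)
Lemma not_fno_class (dom : set (V -> R[i])) (G : (V -> R[i]) -> V -> R[i]) :
  (leb B < +oo)%E ->
  (forall f, cintegrable leb E f -> dom f /\
    forall x, E x -> G f x = cintegral leb E (fun z => K x z * f z)) ->
  (forall f x, cintegrable leb E f -> cintegrable leb E (fun z => K x z * f z)) ->
  ~ fno_class E (graph_on E dom G).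
Proof.
move=> Boo HG iK [M mM eG].
pose f (x : V) : R[i] := (\1_B x)%:C%C.
pose g x : R[i] := f (translate (- s) x).
have mBs : measurable (translate (- s) @^-1` B) by exact: measurable_translate_preimage.
have f0 x : ~ B x -> f x = 0 by move=> nB; rewrite /f indicE memNset.
have gsE x : g (translate s x) = f x by rewrite /g translateK.
(* The translate of [B] is also inside [E], so extension by zero leaves both test signals
   unchanged. *)
have Bs x : B (translate (- s) x) -> E x.
  by move=> /BsE /=; rewrite -{1}[s]opprK translateK.
have intT : cintegrable leb setT f by exact: cintegrable_indic.
have intgT : cintegrable leb setT g.
  apply: (cintegrable_indic mBs).
  by rewrite -[X in (X < _)%E]/(leb (translate (- s) @^-1` B)) lebesgue_translate.
have pf : patch (fun=> 0) E f = f.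
  apply/funext => x; rewrite /patch; case: ifPn => // /negP; rewrite inE => nE.
  by rewrite f0// => /BE.
have pg : patch (fun=> 0) E g = g.
  apply/funext => x; rewrite /patch; case: ifPn => // /negP; rewrite inE => nE.
  by rewrite /g f0// => /Bs.
have intf : cintegrable leb E f by apply/(cintegrable_mkcond _ _ mE); rewrite pf.
have intg : cintegrable leb E g by apply/(cintegrable_mkcond _ _ mE); rewrite pg.
(* The pair [(h, G h)] lies in the graph of [G], hence in that of the FNO operator, which fixes
   outputs almost everywhere on [E]. *)
have aeG h : cintegrable leb E h ->
    {ae leb, forall x, E x -> G h x = fno E M h x}.
  move=> inth; have : graph_on E dom G (h, G h).
    by split; [exact: (HG h inth).1|exact: aeW].
  by rewrite -eG => -[].
have [x Bx [Gf Gg]] : exists2 x, B x &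
    (E x -> G f x = fno E M f x) /\
    (E (translate s x) -> G g (translate s x) = fno E M g (translate s x)).
  apply: (ae_exists mB B_gt0).
  by apply: filterS2 (aeG f intf) (ae_translate s (aeG g intg)).
have Gfg : G g (translate s x) = G f x.
  rewrite Gf ?Gg; [|exact: BsE|exact: BE].
  by apply: fno_translate => // z; rewrite pf pg gsE.
have iKf : cintegrable leb setT (fun z => K x z * f z).
  have := (cintegrable_mkcond _ _ mE).1 (iK f x intf).
  apply: eq_cintegrable => // z _; rewrite -{2}pf /patch.
  by case: ifP => //; rewrite mulr0.
have iKg : cintegrable leb setT (fun z => K (translate s x) z * g z).
  have := (cintegrable_mkcond _ _ mE).1 (iK g (translate s x) intg).
  apply: eq_cintegrable => // z _; rewrite -{2}pg /patch.
  by case: ifP => //; rewrite mulr0.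
(* The substitution of [translate s z] for [z] brings the output for [g] back to an integral against
   [f]. *)
pose h z := K (translate s x) (translate s z) * f z.
have ih : cintegrable leb setT h.
  have := cintegrable_translate s iKg.
  by apply: eq_cintegrable => // z _; rewrite gsE.
have Gf1 : G f x = cintegral leb setT (fun z => K x z * f z).
  rewrite (HG f intf).2; last exact: BE.
  rewrite cintegral_mkcond; apply: eq_cintegral => z _.
  by rewrite -{2}pf /patch; case: ifP => //; rewrite mulr0.
have Gg1 : G g (translate s x) = cintegral leb setT h.
  rewrite (HG g intg).2; last exact: BsE.
  rewrite cintegral_mkcond.
  rewrite (eq_cintegral _ (g := fun z => K (translate s x) z * g z)); last first.
    by move=> z _; rewrite -{2}pg /patch; case: ifP => //; rewrite mulr0.
  rewrite -(cintegral_translate s iKg).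
  by apply: eq_cintegral => z _; rewrite gsE.
(* As [f] is a real indicator, real parts of the outputs are integrals over [B] of real parts of the
   kernel. *)
have Ref (u : V -> R[i]) : complex.Re (cintegral leb setT (fun z => u z * f z)) =
    \int[leb]_(z in B) complex.Re (u z).
  rewrite [RHS]Rintegral_mkcond; apply: eq_Rintegral => z _.
  rewrite Re_complexM /f /= mulr0 subr0 /patch indicE.
  by case: ifP => _; rewrite ?mulr1 ?mulr0.
have iB (u : V -> R[i]) : cintegrable leb setT (fun z => u z * f z) ->
    leb.-integrable B (EFin \o (fun z => complex.Re (u z))).
  move=> [/(integrableS measurableT mB (@subsetT _ _)) + _].
  apply: eq_integrable => // z; rewrite inE => Bz /=.
  by rewrite /f indicE mem_set// mulr1.
have : 0 < \int[leb]_(z in B)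
    (complex.Re (K x z) - complex.Re (K (translate s x) (translate s z))).
  apply: Rintegral_gt0 => //.
    rewrite (_ : _ \o _ = fun z => ((complex.Re (K x z))%:E -
      (complex.Re (K (translate s x) (translate s z)))%:E)%E)//.
    exact: (integrableB mB (iB _ iKf) (iB _ ih)).
  by move=> z Bz; rewrite subr_gt0 K_lt.
rewrite RintegralB//; [|exact: iB iKf|exact: iB ih].
by rewrite -!Ref -Gf1 -Gg1 Gfg subrr ltxx.
Qed.

End translation_covariance.

(** * A kernel that is not translation-invariant *)

Section sigmoid.
Context {R : realType} {d : nat}.
Notation V := (rspace R d.+1).

(** The logistic function of minus the first coordinate, so that positive shifts by [translate]
    decrease it. *)
Definition sigmoid (x : V) : R := (1 + expR (tnth x ord0 : R))^-1.

Lemma sigmoid_gt0 x : 0 < sigmoid x.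
Proof. by rewrite invr_gt0 addr_gt0// expR_gt0. Qed.

Lemma sigmoid_le1 x : sigmoid x <= 1.
Proof.
by rewrite invf_le1 ?lerDl ?expR_ge0// addr_gt0// expR_gt0.
Qed.

Lemma sigmoid_translate_lt s x : 0 < s -> sigmoid (translate s x) < sigmoid x.
Proof.
move=> s0; rewrite /sigmoid tnth_translate /=.
rewrite ltf_pV2 ?posrE ?addr_gt0 ?expR_gt0//.
by rewrite ltrD2l ltr_expR ltrDl.
Qed.

Lemma measurable_sigmoid : measurable_fun setT sigmoid.
Proof.
have h : measurable_fun setT (fun t : R => (1 + expR t)^-1).
  apply: nonincreasing_measurable => // t u tu.
  by rewrite lef_pV2 ?posrE ?addr_gt0 ?expR_gt0// lerD2l ler_expR.
exact: (measurableT_comp h (measurable_tnth ord0)).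
Qed.

Definition amplitude (x : V) : R := Num.sqrt (sigmoid x).

Lemma amplitude_gt0 x : 0 < amplitude x.
Proof. by rewrite sqrtr_gt0 sigmoid_gt0. Qed.

Lemma amplitude_le1 x : amplitude x <= 1.
Proof. by rewrite -[leRHS]sqrtr1 ler_wsqrtr// sigmoid_le1. Qed.

Lemma amplitude_translate_lt s x :
  0 < s -> amplitude (translate s x) < amplitude x.
Proof. by move=> s0; rewrite ltr_sqrt ?sigmoid_gt0// sigmoid_translate_lt. Qed.

Lemma measurable_sqrt : measurable_fun setT (@Num.sqrt R).
Proof. by apply: continuous_measurable_fun; exact: sqrt_continuous. Qed.

Lemma measurable_amplitude : measurable_fun setT amplitude.
Proof. exact: (measurableT_comp measurable_sqrt measurable_sigmoid). Qed.

End sigmoid.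

(** * An ABLE operator with a single active branch *)

Section two_branch_able.
Context {R : realType} {d : nat}.
Notation V := (rspace R d.+1).
Notation leb := (lebesgue_rspace R d.+1).
Context {dc : measure_display} {chi : measurableType dc}.
Variables (E : set V) (mu : probability chi R) (A : set chi) (w : R).
Hypotheses (mE : measurable E) (mA : measurable A).
Hypotheses (muA : mu A = w%:E) (w0 : 0 < w) (w1 : w < 1).
Variable m : V -> R[i].
Hypothesis im : cintegrable leb setT m.

(* The second term only serves to give [p x] total mass 1: the multiplier below
   vanishes off A. *)
Definition branch_density (x : V) (y : chi) : R :=
  \1_A y * sigmoid x + (1 - \1_A y) * ((1 - w * sigmoid x) / (1 - w)).

Definition branch_multiplier (k : V) (y : chi) : R[i] := (\1_A y)%:C%C * m k.

Notation p := branch_density.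
Notation M := branch_multiplier.

Lemma branch_density_in x y : A y -> p x y = sigmoid x.
Proof.
by move=> Ay; rewrite /p indicE mem_set// subrr mul0r addr0 mul1r.
Qed.

Lemma branch_density_ge0 x y : 0 <= p x y.
Proof.
have s0 := sigmoid_gt0 x; have s1 := sigmoid_le1 x.
rewrite /p indicE; case: (y \in A).
  by rewrite subrr mul0r addr0 mul1r ltW.
rewrite mul0r add0r subr0 mul1r divr_ge0 ?subr_ge0 ?(ltW w1)//.
by rewrite -[1]mulr1 ler_pM// ltW.
Qed.

(** A uniform bound keeps every weighted signal integrable, including for [y] off [A]. *)
Lemma branch_density_le x y : p x y <= (1 - w)^-1.
Proof.
have s0 := sigmoid_gt0 x; have s1 := sigmoid_le1 x.
have w1' : 0 < 1 - w by rewrite subr_gt0.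
have v1 : 1 <= (1 - w)^-1 by rewrite invf_ge1// gerBl ltW.
rewrite /p indicE; case: (y \in A).
  by rewrite subrr mul0r addr0 mul1r (le_trans s1).
rewrite mul0r add0r subr0 mul1r ler_pdivrMr// mulVf ?gt_eqF//.
by rewrite gerBl mulr_ge0 ?ltW.
Qed.

Lemma measurable_branch_density :
  measurable_fun setT (fun xy : V * chi => p xy.1 xy.2).
Proof.
have mi : measurable_fun setT (fun xy : V * chi => \1_A xy.2 : R).
  apply: (measurableT_comp (f := \1_A : chi -> R)); last exact: measurable_snd.
  exact: measurable_indic.
have ms : measurable_fun setT (fun xy : V * chi => sigmoid xy.1).
  exact: (measurableT_comp measurable_sigmoid measurable_fst).
apply: measurable_funD; apply: measurable_funM => //.
  by apply: measurable_funB => //; exact: measurable_cst.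
apply: measurable_funM; last exact: measurable_cst.
apply: measurable_funB; first exact: measurable_cst.
by apply: measurable_funM => //; exact: measurable_cst.
Qed.

Lemma branch_density_is_density : is_density E mu p.
Proof.
split=> [|x y _|x _]; [|exact: branch_density_ge0|].
  exact: (measurable_funS measurableT (@subsetT _ _) measurable_branch_density).
(* [b] is the value off [A], chosen so that [w * sigmoid x + (1 - w) * b = 1]. *)
set b := (1 - w * sigmoid x) / (1 - w).
have pE y : (p x y)%:E = ((sigmoid x - b)%:E * (\1_A y)%:E + b%:E)%E.
  by rewrite -EFinM -EFinD /p -/b; congr EFin; ring.
have ib : mu.-integrable setT (cst b%:E).
  exact: (finite_measure_integrable_cst mu b measurableT).
have i1 := integrable_indic mu mA.
under eq_integral do rewrite pE.
rewrite integralD//; last exact: integrableZl.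
rewrite integralZl// integral_indic// setIT integral_cst//=.
rewrite [X in (_ + _ * X)%E]probability_setT mule1 [X in (_ * X)%E]muA.
rewrite -EFinM -EFinD; congr EFin; rewrite /b; field.
by rewrite subr_eq0 gt_eqF.
Qed.

Lemma branch_multiplier_measurable : multiplier M.
Proof.
apply: cmeasurableM; last first.
  exact: (cmeasurable_comp (cintegrable_cmeasurable im) measurable_fst).
apply: cmeasurable_real.
apply: (measurableT_comp (f := \1_A : chi -> R)); last exact: measurable_snd.
exact: measurable_indic.
Qed.

Lemma cintegral_indicM (c : R[i]) :
  cintegral mu setT (fun y => (\1_A y)%:C%C * c) = w%:C%C * c.
Proof.
have i1 : cintegrable mu setT (fun y => (\1_A y : R)%:C%C).
  by apply: cintegrable_indic => //; rewrite [X in (X < _)%E]muA ltry.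
rewrite mulrC -[w%:C%C](_ : cintegral mu setT (fun y => (\1_A y)%:C%C) = _).
  by rewrite -cintegralZl//; apply: eq_cintegral => y _; rewrite mulrC.
apply: complexP; rewrite /cintegral /=; last by rewrite Rintegral_cst ?mul0r.
by rewrite /Rintegral integral_indic// setIT [X in fine X]muA.
Qed.

Lemma cintegrable_indicM (c : R[i]) :
  cintegrable mu setT (fun y => (\1_A y)%:C%C * c).
Proof.
have i1 : cintegrable mu setT (fun y => (\1_A y : R)%:C%C).
  by apply: cintegrable_indic => //; rewrite [X in (X < _)%E]muA ltry.
apply: (eq_cintegrable measurableT _ (cintegrableZl c measurableT i1)) => y _.
exact: mulrC.
Qed.

(** For [y] in [A], the ABLE transform of [f] is the Fourier transform of [tilt f]. *)
Let tilt (f : V -> R[i]) x : R[i] := (amplitude x)%:C%C * f x.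

Let cintegrable_tilt f : cintegrable leb E f -> cintegrable leb E (tilt f).
Proof.
apply: (cintegrableM_bounded (c := 1)) => //.
  apply: cmeasurable_real.
  exact: (measurable_funS measurableT (@subsetT _ _) measurable_amplitude).
move=> x _ /=; rewrite normr0 ler01; split=> //.
by rewrite ger0_norm ?amplitude_le1// ltW ?amplitude_gt0.
Qed.

Lemma branch_transform f k y : M k y * able_transform E p f k y =
  (\1_A y)%:C%C * (m k * fourier E (tilt f) k).
Proof.
rewrite /M indicE; case: (boolP (y \in A)) => [|_]; last by rewrite !mul0r.
rewrite inE => Ay; rewrite !mul1r; congr (_ * (_ * _)).
apply: eq_cintegral => x _; rewrite branch_density_in// /tilt -/(amplitude x).
by rewrite mulrCA mulrA.
Qed.

Lemma branch_inv_fourier f x y :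
  (Num.sqrt (p x y))%:C%C *
    inv_fourier (fun k => M k y * able_transform E p f k y) x =
  (\1_A y)%:C%C * ((amplitude x)%:C%C *
    inv_fourier (fun k => m k * fourier E (tilt f) k) x).
Proof.
rewrite (_ : (fun k => M k y * able_transform E p f k y) =
  fun k => (\1_A y)%:C%C * (m k * fourier E (tilt f) k)); last first.
  by apply/funext => k; rewrite branch_transform.
rewrite indicE; case: (boolP (y \in A)) => [|_].
  rewrite inE => Ay; rewrite branch_density_in// mul1r -/(amplitude x).
  apply: congr1; apply: (f_equal (fun h => inv_fourier h x)).
  by apply/funext => k; rewrite mul1r.
rewrite mul0r /inv_fourier.
rewrite (eq_cintegral _ (g := fun=> 0)); first by rewrite cintegral0 ?mulr0.
by move=> k _; rewrite mul0r mulr0.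
Qed.

(** Boundedness of the density and integrability of [m] make the domain all integrable signals, as
    [not_fno_class] requires. *)
Lemma branch_dom f : cintegrable leb E f -> able_dom E mu p M f.
Proof.
move=> intf; split => //.
- apply: aeW => y.
  apply: (cintegrableM_bounded (c := Num.sqrt (1 - w)^-1)) => //.
    apply: cmeasurable_real; apply: (measurableT_comp measurable_sqrt).
    apply: (measurable_funS measurableT (@subsetT _ _)).
    exact: (measurable_fun_pair1 y measurable_branch_density).
  move=> x _ /=; rewrite normr0 sqrtr_ge0 ger0_norm ?sqrtr_ge0//.
  by split => //; rewrite ler_wsqrtr// branch_density_le.
- apply: aeW => y.
  have := cintegrableZl ((\1_A y)%:C%C) measurableT
    (cintegrable_mul_fourier mE im (cintegrable_tilt intf)).
  by apply: eq_cintegrable => // k _; rewrite branch_transform.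
- apply: aeW => x _.
  have := cintegrable_indicM ((amplitude x)%:C%C *
    inv_fourier (fun k => m k * fourier E (tilt f) k) x).
  by apply: eq_cintegrable => // y _; rewrite branch_inv_fourier.
Qed.

Lemma branch_kernelE x z : able_kernel mu p M x z =
  w%:C%C * ((amplitude x)%:C%C * conv_kernel m (vsub x z) * (amplitude z)%:C%C).
Proof.
rewrite -cintegral_indicM; apply: eq_cintegral => y _.
have -> : multiplier_kernel M (vsub x z) y =
    (\1_A y)%:C%C * conv_kernel m (vsub x z).
  rewrite /multiplier_kernel /conv_kernel mulrCA; apply: congr1.
  rewrite -cintegralZl//; last first.
    by apply: cintegrable_cexpiM => //; exact: measurable_vdotr.
  by apply: eq_cintegral => k _; rewrite /M mulrCA.
rewrite indicE; case: (boolP (y \in A)) => [|_].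
  by rewrite inE => Ay; rewrite !branch_density_in// !mul1r.
by rewrite !mul0r mulr0 mul0r.
Qed.

Lemma cintegrable_branch_kernel f x : cintegrable leb E f ->
  cintegrable leb E (fun z => able_kernel mu p M x z * f z).
Proof.
move=> intf.
have := cintegrableZl (w%:C%C * (amplitude x)%:C%C) mE
  (cintegrable_conv_kernel mE im (cintegrable_tilt intf) x).
apply: eq_cintegrable => // z _; rewrite branch_kernelE /tilt; ring.
Qed.

Lemma branch_ableE f x : cintegrable leb E f ->
  able E mu p M f x =
  cintegral leb E (fun z => able_kernel mu p M x z * f z).
Proof.
move=> intf.
rewrite /able /able_synthesis.
rewrite (eq_cintegral _ (fun y _ => branch_inv_fourier f x y)) cintegral_indicM.
rewrite (inv_fourier_mul_fourier mE im (cintegrable_tilt intf)) mulrA -cintegralZl//.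
  by apply: eq_cintegral => z _; rewrite branch_kernelE /tilt; ring.
exact: (cintegrable_conv_kernel mE im (cintegrable_tilt intf)).
Qed.

Lemma Re_branch_kernel x z : complex.Re (able_kernel mu p M x z) =
  w * complex.Re (conv_kernel m (vsub x z)) * (amplitude x * amplitude z).
Proof.
by rewrite branch_kernelE !(Re_complexM, Im_complexM) /=; ring.
Qed.

(** A common shift preserves the positive convolution factor and strictly decreases both
    amplitudes. *)
Lemma branch_kernel_translate_lt s x z : 0 < s ->
  0 < complex.Re (conv_kernel m (vsub x z)) ->
  complex.Re (able_kernel mu p M (translate s x) (translate s z)) <
  complex.Re (able_kernel mu p M x z).
Proof.
move=> s0 r0.
have := Re_branch_kernel (translate s x) (translate s z); rewrite vsub_translate => Ks.
rewrite [ltLHS]Ks [ltRHS]Re_branch_kernel.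
rewrite (ltr_pM2l (mulr_gt0 w0 r0)).
by apply: ltr_pM; rewrite ?amplitude_translate_lt// ltW ?amplitude_gt0.
Qed.

End two_branch_able.

(** * Low-pass multipliers and positivity of their kernels *)

Section low_pass.
Context {R : realType} {d : nat}.
Notation V := (rspace R d).
Notation leb := (lebesgue_rspace R d).

Definition low_pass (r : R) (k : V) : R[i] := (\1_(box d r) k)%:C%C.

Lemma cintegrable_low_pass r : 0 <= r -> cintegrable leb setT (low_pass r).
Proof.
move=> r0; apply: cintegrable_indic; first exact: measurable_box.
exact: lebesgue_box_lty.
Qed.

(** Up to a positive factor, the real part is the integral over the cube of the cosine of a phase
    smaller than 1, hence smaller than half of pi. *)
Lemma conv_low_pass_gt0 (r : R) (u : V) : 0 < r ->
  (forall k, box d r k -> `|vdot k u| < 1) ->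
  0 < complex.Re (conv_kernel (low_pass r) u).
Proof.
move=> r0 ku.
have mbox := @measurable_box R d r.
rewrite Re_complexM /= mul0r subr0 mulr_gt0//.
  by rewrite invr_gt0 exprn_gt0// mulr_gt0// pi_gt0.
have -> : \int[leb]_k complex.Re (cexpi (vdot k u) * low_pass r k) =
    \int[leb]_(k in box d r) cos (vdot k u).
  rewrite [RHS]Rintegral_mkcond; apply: eq_Rintegral => k _.
  rewrite Re_complexM /= mulr0 subr0 /patch indicE.
  by case: ifP => _; rewrite ?mulr1 ?mulr0.
apply: Rintegral_gt0 => //.
- exact: lebesgue_box_gt0.
- apply: measurable_bounded_integrable => //.
  + exact: lebesgue_box_lty (ltW r0).
  + apply: measurable_funTS.
    apply: (measurableT_comp (f := cos)); last exact: measurable_vdotr.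
    by apply: continuous_measurable_fun; exact: continuous_cos.
  + exists 1; split; first exact: num_real.
    move=> c c1 k _ /=; apply: le_trans (ltW c1).
    by rewrite ler_norml cos_geN1 cos_le1.
- move=> k /ku; rewrite ltr_norml => /andP[k1 k2].
  have pi2 := @pihalf_ge1 R; apply: cos_gt0_pihalf.
  by rewrite (lt_le_trans k2)// (le_lt_trans _ k1)// lerN2.
Qed.

Lemma norm_vdot_le (a b : R) (k u : V) : 0 <= a ->
  box d a k -> box d b u -> `|vdot k u| <= (a * b) *+ d.
Proof.
move=> a0 ka ub; apply: le_trans (ler_norm_sum _ _ _) _.
apply: (@le_trans _ _ (\sum_(i < d) a * b)).
  by apply: ler_sum => i _; rewrite normrM ler_pM.
by rewrite sumr_const card_ord.
Qed.

Lemma box_vsub (r : R) (x z : V) : box d r x -> box d r z -> box d (r + r) (vsub x z).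
Proof.
by move=> xr zr i; rewrite tnth_vsub (le_trans (ler_normB _ _))// lerD.
Qed.

End low_pass.

Lemma exists_able_not_fno {R : realType} {d : nat} {dc : measure_display}
    {chi : measurableType dc} (E : set (rspace R d.+1)) (mu : probability chi R)
    (A : set chi) :
  measurable E -> (0 < lebesgue_rspace R d.+1 E)%E ->
  measurable A -> (0 < mu A < 1)%E ->
  exists p M, [/\ is_density E mu p, multiplier M,
    forall f, cintegrable (lebesgue_rspace R d.+1) E f ->
      able_dom E mu p M f /\
      forall x, E x -> able E mu p M f x =
        cintegral (lebesgue_rspace R d.+1) E (fun z => able_kernel mu p M x z * f z),
    ~ translation_invariant E (able_kernel mu p M) &
    ~ fno_class E (graph_on E (able_dom E mu p M) (able E mu p M))].
Proof.
move=> mE E0 mA muA01.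
have [w muA] : exists w : R, mu A = w%:E.
  exists (fine (mu A)); rewrite fineK// ge0_fin_numE//.
  by move/andP : muA01 => [_ /lt_trans -> //]; rewrite ltry.
move: muA01; rewrite muA !lte_fin => /andP[w0 w1].
(* Cutting [E] down to a cube first bounds the differences [vsub x z], so one cutoff frequency
   serves all pairs. *)
have [r r0 Er0] := exists_box mE E0.
have mEr : measurable (E `&` box d.+1 r).
  by apply: measurableI => //; exact: measurable_box.
have [s s0 Bs0] := exists_translate_overlap mEr Er0.
set B := _ `&` _ in Bs0.
have mB : measurable B.
  by apply: measurableI => //; exact: measurable_translate_preimage.
(* frequencies in [box d.+1 a] have phase less than 1 on differences of points of
   [box d.+1 r] *)
pose a : R := ((r + r) *+ d.+1 + 1)^-1.
have D0 : 0 < (r + r) *+ d.+1 + 1 :> R.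
  by rewrite ltr_wpDl// mulrn_wge0// addr_ge0.
have a0 : 0 < a by rewrite invr_gt0.
have im := @cintegrable_low_pass R d.+1 a (ltW a0).
exists (branch_density A w), (branch_multiplier A (low_pass a)).
have K_lt x z : B x -> B z ->
    complex.Re (able_kernel mu (branch_density A w)
      (branch_multiplier A (low_pass a)) (translate s x) (translate s z)) <
    complex.Re (able_kernel mu (branch_density A w)
      (branch_multiplier A (low_pass a)) x z).
  move=> [[_ xr] _] [[_ zr] _].
  apply: branch_kernel_translate_lt => //.
  apply: conv_low_pass_gt0 => // k ka.
  apply: le_lt_trans (norm_vdot_le (ltW a0) ka (box_vsub xr zr)) _.
  (* The [+ 1] in the denominator of [a] makes the inequality strict. *)
  rewrite -mulrnAr /a mulrC ltr_pdivrMr// mul1r ltrDl//.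
have BE : B `<=` E by move=> x [[]].
have BsE : B `<=` translate s @^-1` E by move=> x [_ []].
split.
- exact: branch_density_is_density.
- exact: branch_multiplier_measurable.
- move=> f intf; split; first exact: branch_dom.
  by move=> x _; exact: branch_ableE.
- exact: (not_translation_invariant mB Bs0 BE BsE K_lt).
- apply: (not_fno_class mE mB Bs0 BE BsE K_lt).
  + apply: le_lt_trans (lebesgue_box_lty d.+1 r0).
    apply: le_measure; rewrite ?inE//; first exact: measurable_box.
    by move=> x [[]].
  + by move=> f intf; split; [exact: branch_dom|move=> x _; exact: branch_ableE].
  + by move=> f x intf; exact: cintegrable_branch_kernel.
Qed.

Lemma fno_class_proper {R : realType} {d : nat} {dc : measure_display}
    {chi : measurableType dc} (E : set (rspace R d.+1)) (mu : probability chi R)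
    (A : set chi) :
  measurable E -> (0 < lebesgue_rspace R d.+1 E)%E ->
  measurable A -> (0 < mu A < 1)%E ->
  fno_class E `<` able_class_on E mu.
Proof.
move=> mE E0 mA muA; split; first exact: fno_class_sub_able.
have [p [M [dp mM _ _ nfno]]] := exists_able_not_fno mE E0 mA muA.
by move=> sub; apply: nfno; apply: sub; exists p, M.
Qed.

Theorem theorem2 (R : realType) (d : nat) (hd : (0 < d)%N)
    (E : set (rspace R d)) (mE : measurable E)
    (E_gt0 : (0 < lebesgue_rspace R d E)%E) :
  (forall (dc : measure_display) (chi : measurableType dc)
      (mu : probability chi R),
    [/\
      forall p : rspace R d -> chi -> R, is_density E mu p ->
        (exists c : R, forall x y, E x -> p x y = c) ->
        [/\ forall f k y, able_transform E p f k y = fourier E f k,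
            forall g x, E x ->
              able_synthesis mu p (fun k _ => g k) x = inv_fourier g x,
            forall M : rspace R d -> R[i],
              able_dom E mu p (fun k _ => M k) = fno_dom E M /\
              forall f x, E x ->
                able E mu p (fun k _ => M k) f x = fno E M f x &
            forall (M : rspace R d -> chi -> R[i]) f,
              multiplier M -> cintegrable (lebesgue_rspace R d) E f ->
              cintegrable (lebesgue_rspace R d \x mu)%E setT
                (fun ky => M ky.1 ky.2 * fourier E f ky.1) ->
              let M_mean k := cintegral mu setT (M k) in
              [/\ able_dom E mu p M f, fno_dom E M_mean f &
                  forall x, E x -> able E mu p M f x = fno E M_mean f x]],
      fno_class E `<=` able_class_on E mu &
      (exists2 A : set chi, measurable A & (0 < mu A < 1)%E) ->
        (exists p M, 
          [/\ is_density E mu p, multiplier M,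
              forall f, cintegrable (lebesgue_rspace R d) E f ->
                able_dom E mu p M f /\
                forall x, E x ->
                  able E mu p M f x =
                  cintegral (lebesgue_rspace R d) E
                    (fun z => able_kernel mu p M x z * f z),
              ~ translation_invariant E (able_kernel mu p M) &
              ~ fno_class E (graph_on E (able_dom E mu p M) (able E mu p M))]) /\
        fno_class E `<` able_class_on E mu]) /\
  fno_class E `<` able_class E.
Proof.
(* Positive dimension supplies the first axis along which the counterexample is shifted. *)
case: d hd E mE E_gt0 => // d _ E mE E_gt0.
split=> [dc chi mu|].
  split; last first.
  - move=> [A mA muA]; split; first exact: exists_able_not_fno muA.
    exact: fno_class_proper muA.
  - exact: fno_class_sub_able.
  move=> p dp pc; have p1 := constant_density_eq1 dp pc; split.
  - by move=> f k y; exact: able_transform_constant.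
  - by move=> g x; exact: able_synthesis_constant.
  - move=> M; split; first exact: able_dom_constant.
    by move=> f x; exact: able_constant.
  - by move=> M f; exact: able_constant_mean.
have half01 : 0 <= (2^-1 : R) <= 1 by lra.
(* A fair coin: the simplest auxiliary space with an event of probability strictly between 0 and
   1. *)
pose mu : probability bool R := bernoulli_prob 2^-1.
have muA : (0 < mu [set true] < 1)%E.
  rewrite /mu /= bernoulli_probE// !diracE mem_set// memNset//=.
  by rewrite mule1 mule0 adde0 !lte_fin; lra.
have mtrue : measurable ([set true] : set bool) by [].
have [sub nsub] := fno_class_proper mE E_gt0 mtrue muA.
split=> [G /sub GA|sub'].
  by exists _, _, mu.
have [p [M [dp mM _ _ nfno]]] :=
  exists_able_not_fno mE E_gt0 mtrue muA.
by apply: nfno; apply: sub'; exists _, _, mu, p, M.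
Qed.
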